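(* Let $G$ be a finite group acting smoothly on a manifold $M$. Then the functor $\Pi^{\mathrm{op}}\colon \mathsf{Enter}(M)\to\mathsf{Enter}(M/G)$ is a pullback of the forgetful functor $\mathcal{O}_{G,*}\to\mathcal{O}_G$ along a (classifying) functor $\mathsf{Enter}(M/G)\to\mathcal{O}_G$; that is, there exist functors $\mathsf{Enter}(M/G)\to\mathcal{O}_G$ and $\mathsf{Enter}(M)\to\mathcal{O}_{G,*}$ such that the square with top edge $\mathsf{Enter}(M)\to\mathcal{O}_{G,*}$, left edge $\Pi^{\mathrm{op}}$, right edge the forgetful functor $\mathcal{O}_{G,*}\to\mathcal{O}_G$, and bottom edge $\mathsf{Enter}(M/G)\to\mathcal{O}_G$ commutes and is a pullback square of categories.
   Context: $I=[0,1]$. A poset $P$ carries the Alexandrov topology (open sets = upward closed sets). A stratification of a space $X$ is a continuous map $\mathcal{S}\colon X\to P$ to a poset. An exit path is a continuous $f\colon I\to X$ with $\mathcal{S}(f(s))\le\mathcal{S}(f(t))$ whenever $s\le t$. An exit path homotopy is a homotopy $\mathcal{H}\colon I\times I\to X$ rel endpoints such that each $\mathcal{H}|_{I\times\{s\}}$ is an exit path. The exit path category $\mathsf{Exit}(X)$ has the points of $X$ as objects; morphisms $x\to y$ are exit paths from $x$ to $y$ modulo exit path homotopy; composition is concatenation and identities are constant paths. $\mathsf{Enter}(X):=\mathsf{Exit}(X)^{\mathrm{op}}$. For a finite group $G$, $P_G$ is the poset of conjugacy classes of subgroups of $G$, with $[H]\le[K]$ iff $H$ is conjugate to a subgroup of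 $K$. For $G$ acting on $M$ with stabilizers $G_x$, the space $M$ is stratified by $x\mapsto[G_x]\in P_G^{\mathrm{op}}$, and $M/G$ (quotient topology) is stratified by $[x]\mapsto[G_x]\in P_G^{\mathrm{op}}$. The quotient map $\pi\colon M\to M/G$ is compatible with these stratifications and induces the functor $\Pi\colon\mathsf{Exit}(M)\to\mathsf{Exit}(M/G)$, $x\mapsto[x]$, $[f]\mapsto[\pi\circ f]$. $\mathcal{O}_G$ is the full subcategory of the category of $G$-sets on the $G$-sets with transitive action. $\mathcal{O}_{G,*}$ is the category of pointed transitive $G$-sets $(X,x)$ (with $x\in X$ an arbitrary distinguished element), with morphisms the $G$-equivariant maps preserving the distinguished element. The forgetful functor forgets the distinguished element. *)

(* Defs.v *)
From HB Require Import structures.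
From mathcomp Require Import all_boot all_order all_algebra all_fingroup lra.
From mathcomp Require Import all_classical all_reals all_analysis homotopy.
Import generic_quotient.

Set Implicit Arguments.
Unset Strict Implicit.
Unset Printing Implicit Defensive.

Import Order.TTheory GRing.Theory Num.Theory.
Import numFieldNormedType.Exports.

Local Open Scope classical_set_scope.
Local Open Scope ring_scope.
Local Open Scope quotient_scope.

Record category := Category {
  obj :> Type;
  hom : obj -> obj -> Type;
  idc : forall a, hom a a;
  comp : forall a b c, hom b c -> hom a b -> hom a c;
  comp1c : forall a b (f : hom a b), comp (idc b) f = f;
  compc1 : forall a b (f : hom a b), comp f (idc a) = f;
  compA : forall a b c d (h : hom c d) (g : hom b c) (f : hom a b),
    comp h (comp g f) = comp (comp h g) f
}.
Arguments hom {c} _ _ : rename.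
Arguments idc {c} a : rename.
Arguments comp {c a b c0} _ _ : rename.

Record functor (C D : category) := Functor {
  fobj :> C -> D;
  fmap : forall a b, hom a b -> hom (fobj a) (fobj b);
  fmap1 : forall a, fmap (idc a) = idc (fobj a);
  fmapM : forall a b c (g : hom b c) (f : hom a b),
    fmap (comp g f) = comp (fmap g) (fmap f)
}.
Arguments fmap {C D} f {a b} _ : rename.

Section comp_functor.
Variables (C D E : category) (G : functor D E) (F : functor C D).

Definition comp_functor : functor C E.
Proof.
refine (@Functor C E (fun a => G (F a)) (fun a b f => fmap G (fmap F f)) _ _).
- by move=> a; rewrite !fmap1.
- by move=> a b c g f; rewrite !fmapM.
Defined.
End comp_functor.

Section opposite.
Definition op_category (C : category) : category.
Proof.
refine (@Category C (fun a b => hom b a) (fun a => idc a)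
  (fun a b c g f => comp f g) _ _ _).
- by move=> a b f; rewrite compc1.
- by move=> a b f; rewrite comp1c.
- by move=> a b c d h g f; rewrite compA.
Defined.

Definition op_functor (C D : category) (F : functor C D) :
  functor (op_category C) (op_category D).
Proof.
refine (@Functor (op_category C) (op_category D) (fun a => F a)
  (fun a b f => fmap F f) _ _).
- by move=> a; exact: fmap1.
- by move=> a b c g f; exact: fmapM.
Defined.
End opposite.

Definition full_subcategory (C : category) (P : C -> Prop) : category.
Proof.
refine (@Category {a : C | P a} (fun a b => hom (sval a) (sval b))
  (fun a => idc (sval a)) (fun a b c g f => comp g f) _ _ _).
- by move=> a b f; exact: comp1c.
- by move=> a b f; exact: compc1.
- by move=> a b c d h g f; exact: compA.
Defined.

(* Strict pullback in the 1-category of categories: equality of functors is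
   Leibniz equality, not natural isomorphism. *)
Definition is_pullback (A B C D : category) (top : functor A B)
    (left : functor A C) (right : functor B D) (bottom : functor C D) : Prop :=
  comp_functor right top = comp_functor bottom left /\
  forall (E : category) (p : functor E B) (q : functor E C),
    comp_functor right p = comp_functor bottom q ->
    exists! u : functor E A,
      comp_functor top u = p /\ comp_functor left u = q.

Section total_action.
Variables (gT : finGroupType) (X : Type) (rho : {action gT &-> X}).

Lemma total_actM (x : X) (g h : gT) : rho x (g * h)%g = rho (rho x g) h.
Proof. by case: rho => f [finj fM] /=; apply: fM; rewrite finset.in_setT. Qed.

Lemma total_act1 (x : X) : rho x 1%g = x.
Proof.
have := total_actM x 1%g 1%g; rewrite mulg1.
by case: rho => f [finj fM] /= /finj.
Qed.

Lemma total_actK (x : X) (g : gT) : rho (rho x g) (g^-1)%g = x.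
Proof. by rewrite -total_actM mulgV total_act1. Qed.
End total_action.

Section orbit_category.
Variable gT : finGroupType.

(* A right action of the whole group [gT], the convention of [action]; left
   G-sets correspond to these through inverses. *)
Record gset := GSet {
  gset_sort :> Type;
  gset_act : {action gT &-> gset_sort}
}.

Record gmap (X Y : gset) := GMap {
  gmap_fun :> X -> Y;
  gmap_equivariant : morph_act (gset_act X) (gset_act Y) gmap_fun id
}.

Lemma gmap_eqP (X Y : gset) (f g : gmap X Y) : f =1 g -> f = g.
Proof.
case: f g => [f hf] [g hg] /= fg.
have {}fg : f = g by apply/funext.
by subst g; rewrite (Prop_irrelevance hf hg).
Qed.

Definition gmap_id (X : gset) : gmap X X :=
  @GMap X X id (fun _ _ => erefl).

Definition gmap_comp (X Y Z : gset) (g : gmap Y Z) (f : gmap X Y) : gmap X Z.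
Proof.
by refine (@GMap X Z (g \o f) _) => x a /=; rewrite !gmap_equivariant.
Defined.

Definition gset_category : category.
Proof.
refine (@Category gset gmap gmap_id gmap_comp _ _ _);
  by move=> *; exact: gmap_eqP.
Defined.

(* A transitive G-set is nonempty. *)
Definition transitive_gset (X : gset) : Prop :=
  inhabited X /\ forall x y : X, exists a : gT, gset_act X x a = y.

Definition orbit_category : category :=
  @full_subcategory gset_category transitive_gset.

Record pointed_orbit := PointedOrbit {
  po_orbit :> orbit_category;
  po_point : sval po_orbit
}.

Definition pointed_orbit_category : category.
Proof.
refine (@Category pointed_orbit
  (fun X Y => {f : gmap (sval (po_orbit X)) (sval (po_orbit Y)) |
                 f (po_point X) = po_point Y})
  (fun X => exist _ (gmap_id (sval (po_orbit X))) erefl)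
  (fun X Y Z g f => exist _ (gmap_comp (sval g) (sval f)) _) _ _ _).
- by move=> X Y [f hf]; apply: eq_exist; exact: gmap_eqP.
- by move=> X Y [f hf]; apply: eq_exist; exact: gmap_eqP.
- by move=> X Y Z W [h hh] [g hg] [f hf]; apply: eq_exist; exact: gmap_eqP.
Unshelve.
by rewrite /= (svalP f) (svalP g).
Defined.

Definition forget_point : functor pointed_orbit_category orbit_category.
Proof.
by refine (@Functor pointed_orbit_category orbit_category po_orbit
  (fun X Y f => sval f) _ _).
Defined.

End orbit_category.

Definition alexandrov d (P : porderType d) : Type := P.

Section alexandrov.
Context {d : Order.disp_t} {P : porderType d}.
Local Notation A := (alexandrov P).

HB.instance Definition _ := Choice.on A.

Definition upward_closed (U : set P) : Prop :=
  forall x y : P, (x <= y)%O -> U x -> U y.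

Let upT : upward_closed setT. Proof. by []. Qed.

Let upI : setI_closed upward_closed.
Proof. by move=> U V hU hV x y xy [/(hU _ _ xy) ? /(hV _ _ xy)]. Qed.

Let up_bigU (I : Type) (f : I -> set P) :
  (forall i, upward_closed (f i)) -> upward_closed (\bigcup_i f i).
Proof. by move=> hf x y xy [i _ /(hf i _ _ xy)]; exists i. Qed.

HB.instance Definition _ := isOpenTopological.Build A upT upI up_bigU.

Lemma alexandrov_openE (U : set A) : open U = upward_closed U.
Proof. by []. Qed.

End alexandrov.

Record stratification d (P : porderType d) (X : topologicalType) :=
  Stratification {
    stratum :> X -> P;
    stratum_continuous : continuous (stratum : X -> alexandrov P)
  }.

Lemma pair_continuous (T U V : topologicalType) (f : T -> U) (g : T -> V) :
  continuous f -> continuous g -> continuous (fun t => (f t, g t)).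
Proof. by move=> cf cg t; apply: cvg_pair; [exact: cf|exact: cg]. Qed.

Lemma fst_continuous (U V : topologicalType) : continuous (@fst U V).
Proof. by move=> t; exact: cvg_fst. Qed.

Lemma snd_continuous (U V : topologicalType) : continuous (@snd U V).
Proof. by move=> t; exact: cvg_snd. Qed.

Lemma comp_continuous (T U V : topologicalType) (f : T -> U) (g : U -> V) :
  continuous f -> continuous g -> continuous (fun t => g (f t)).
Proof. by move=> cf cg t; apply: continuous_comp; [exact: cf|exact: cg]. Qed.

Section real_continuity.
Variables (R : realType) (T : topologicalType).
Implicit Types f g : T -> R.

Lemma real_addf_continuous f g :
  continuous f -> continuous g -> continuous (fun t => f t + g t).
Proof. by move=> cf cg t; exact: (cvgD (cf t) (cg t)). Qed.

Lemma real_subf_continuous f g :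
  continuous f -> continuous g -> continuous (fun t => f t - g t).
Proof. by move=> cf cg t; exact: (cvgB (cf t) (cg t)). Qed.

Lemma real_mulf_continuous f g :
  continuous f -> continuous g -> continuous (fun t => f t * g t).
Proof. by move=> cf cg t; exact: (cvgM (cf t) (cg t)). Qed.

Lemma real_maxf_continuous f g :
  continuous f -> continuous g -> continuous (fun t => Num.max (f t) (g t)).
Proof. by move=> cf cg t; exact: (continuous_max (cf t) (cg t)). Qed.

Lemma real_minf_continuous f g :
  continuous f -> continuous g -> continuous (fun t => Num.min (f t) (g t)).
Proof. by move=> cf cg t; exact: (continuous_min (cf t) (cg t)). Qed.

Lemma cstf_continuous (U : topologicalType) (c : U) : continuous (fun _ : T => c).
Proof. by move=> t; exact: cvg_cst. Qed.

Lemma idf_continuous : continuous (fun t : T => t).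
Proof. by move=> t; exact: cvg_id. Qed.

End real_continuity.

Definition unit_interval (R : realType) : Type := set_type `[0 : R, 1].

Section unit_interval.
Variable R : realType.
Local Notation I := (unit_interval R).

HB.instance Definition _ := Topological.copy I (set_type `[0 : R, 1]).

Definition ival (t : I) : R := val (t : set_type `[0 : R, 1]).

Lemma ival_itv (t : I) : 0 <= ival t <= 1.
Proof. by have := set_mem (valP (t : set_type `[0 : R, 1])); rewrite /= in_itv. Qed.

Lemma ival_ge0 (t : I) : 0 <= ival t.
Proof. by case/andP: (ival_itv t). Qed.

Lemma ival_le1 (t : I) : ival t <= 1.
Proof. by case/andP: (ival_itv t). Qed.

Lemma ival_inj : injective ival.
Proof. exact: val_inj. Qed.

Lemma ival_continuous : continuous ival.
Proof. exact: initial_continuous. Qed.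

Definition clamp (r : R) : R := Num.max 0 (Num.min r 1).

Lemma clamp_in (r : R) : clamp r \in `[0 : R, 1]%classic.
Proof.
by rewrite mem_setE in_itv /= /clamp le_max lexx /= ge_max ler01 ge_min lexx orbT.
Qed.

Definition proj01 (r : R) : I := exist _ (clamp r) (clamp_in r).

Lemma ival_proj01 (r : R) : ival (proj01 r) = clamp r.
Proof. by []. Qed.

Lemma clamp_id (r : R) : 0 <= r <= 1 -> clamp r = r.
Proof. by move=> /andP[r0 r1]; rewrite /clamp min_l// max_r. Qed.

Lemma clamp_le0 (r : R) : r <= 0 -> clamp r = 0.
Proof. by move=> r0; rewrite /clamp min_l ?max_l// (le_trans r0). Qed.

Lemma clamp_ge1 (r : R) : 1 <= r -> clamp r = 1.
Proof. by move=> r1; rewrite /clamp min_r ?max_r. Qed.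

Lemma clamp_le (r s : R) : r <= s -> clamp r <= clamp s.
Proof. by move=> rs; rewrite /clamp le_max2 // le_min2. Qed.

Lemma proj01K (t : I) : proj01 (ival t) = t.
Proof.
by apply: ival_inj; rewrite ival_proj01 clamp_id// ival_ge0 ival_le1.
Qed.

Lemma clamp_continuous : continuous clamp.
Proof.
apply: real_maxf_continuous; first exact: cstf_continuous.
by apply: real_minf_continuous; [exact: idf_continuous|exact: cstf_continuous].
Qed.

Lemma proj01_continuous : continuous proj01.
Proof. by apply: continuous_comp_initial; exact: clamp_continuous. Qed.

Definition I0 : I := proj01 0.
Definition I1 : I := proj01 1.

Lemma ival0 : ival I0 = 0.
Proof. by rewrite ival_proj01 clamp_le0. Qed.

Lemma ival1 : ival I1 = 1.
Proof. by rewrite ival_proj01 clamp_ge1. Qed.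

Lemma I0_neq_I1 : I0 != I1.
Proof.
apply/eqP => /(congr1 ival); rewrite ival0 ival1 => /eqP.
by rewrite eq_sym oner_eq0.
Qed.

HB.instance Definition _ := isBiPointed.Build I I0_neq_I1.

Lemma ival_zero : ival (zero : I) = 0. Proof. exact: ival0. Qed.
Lemma ival_one : ival (one : I) = 1. Proof. exact: ival1. Qed.

Lemma proj01_le0 (r : R) : r <= 0 -> proj01 r = zero.
Proof. by move=> r0; apply: ival_inj; rewrite ival_zero ival_proj01 clamp_le0. Qed.

Lemma proj01_ge1 (r : R) : 1 <= r -> proj01 r = one.
Proof. by move=> r1; apply: ival_inj; rewrite ival_one ival_proj01 clamp_ge1. Qed.

Definition half1 (t : I) : I := proj01 (2 * ival t).
Definition half2 (t : I) : I := proj01 (2 * ival t - 1).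

Lemma continuous_proj01 (T : topologicalType) (f : T -> R) :
  continuous f -> continuous (fun t => proj01 (f t)).
Proof.
move=> cf t; apply: (@continuous_comp _ _ _ f proj01); first exact: cf.
exact: proj01_continuous.
Qed.

Lemma half1_continuous : continuous half1.
Proof.
apply: continuous_proj01; apply: real_mulf_continuous.
  exact: cstf_continuous.
exact: ival_continuous.
Qed.

Lemma half2_continuous : continuous half2.
Proof.
apply: continuous_proj01; apply: real_subf_continuous; last exact: cstf_continuous.
by apply: real_mulf_continuous; [exact: cstf_continuous|exact: ival_continuous].
Qed.

Lemma half1_le (s t : I) : ival s <= ival t -> ival (half1 s) <= ival (half1 t).
Proof. by move=> st; apply: clamp_le; lra. Qed.

Lemma half2_le (s t : I) : ival s <= ival t -> ival (half2 s) <= ival (half2 t).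
Proof. by move=> st; apply: clamp_le; lra. Qed.

(* Concatenation: [f] at double speed on [0, 1/2], then [g]. *)
Definition glue (X : Type) (f g : I -> X) (t : I) : X :=
  if ival t <= 2^-1 then f (half1 t) else g (half2 t).

Lemma glue0 (X : Type) (f g : I -> X) : glue f g zero = f zero.
Proof.
rewrite /glue ival_zero invr_ge0 ler0n; congr f; apply: proj01_le0.
by rewrite ival_zero mulr0.
Qed.

Lemma glue1 (X : Type) (f g : I -> X) : glue f g one = g one.
Proof.
rewrite /glue ival_one ifF; last by apply/negbTE; rewrite -ltNge; lra.
by congr g; apply: proj01_ge1; rewrite ival_one; lra.
Qed.

Lemma ival_proj01K (r : R) : 0 <= r <= 1 -> ival (proj01 r) = r.
Proof. exact: clamp_id. Qed.

Lemma glueE1 (X : Type) (f g : I -> X) (r : R) :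
  0 <= r <= 2^-1 -> glue f g (proj01 r) = f (proj01 (2 * r)).
Proof.
move=> /andP[r0 r1]; rewrite /glue /half1 ival_proj01K ?r1//.
by apply/andP; split=> //; lra.
Qed.

Lemma glueE2 (X : Type) (f g : I -> X) (r : R) :
  2^-1 < r <= 1 -> glue f g (proj01 r) = g (proj01 (2 * r - 1)).
Proof.
move=> /andP[r0 r1]; rewrite /glue /half2 ival_proj01K.
  by rewrite leNgt r0.
by apply/andP; split=> //; lra.
Qed.

End unit_interval.

Lemma paste_continuous (R : realType) (T X : topologicalType) (p : T -> R)
    (c : R) (f g : T -> X) :
  continuous p -> continuous f -> continuous g ->
  (forall t, p t = c -> f t = g t) ->
  continuous (fun t => if p t <= c then f t else g t).
Proof.
move=> cp cf cg fg; apply/continuous_subspace_setT.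
have -> : setT = [set t | p t <= c] `|` [set t | c <= p t].
  by apply/seteqP; split=> // t _ /=; case/orP: (le_total (p t) c); [left|right].
apply: withinU_continuous.
- exact: (@preimage_closed T R p [set r | r <= c] (fun t _ => cp t)
    (@closed_le R c)).
- exact: (@preimage_closed T R p [set r | c <= r] (fun t _ => cp t)
    (@closed_ge R c)).
- apply: (@subspace_eq_continuous _ _ _ f); last exact: continuous_subspaceT.
  by move=> t /set_mem /= tc; rewrite /from_subspace tc.
- apply: (@subspace_eq_continuous _ _ _ g); last exact: continuous_subspaceT.
  move=> t /set_mem /= ct; rewrite /from_subspace; case: ifP => // tc.
  by rewrite fg//; apply/eqP; rewrite eq_le tc.
Qed.

Section exit_paths.
Variables (R : realType) (d : Order.disp_t) (P : porderType d).
Variables (X : topologicalType) (S : stratification P X).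
Local Notation I := (unit_interval R).

Definition exiting (f : I -> X) : Prop :=
  forall s t : I, ival s <= ival t -> (S (f s) <= S (f t))%O.

Record exit_path (x y : X) := ExitPath {
  ep_path :> {path I from x to y in X};
  ep_exiting : exiting ep_path
}.

HB.instance Definition _ (x y : X) := gen_eqMixin (exit_path x y).
HB.instance Definition _ (x y : X) := gen_choiceMixin (exit_path x y).

Definition mk_exit_path (x y : X) (f : I -> X) (cf : continuous f)
    (f0 : f zero = x) (f1 : f one = y) (ef : exiting f) : exit_path x y :=
  @ExitPath x y (mk_path cf f0 f1) ef.

Lemma ep_continuous (x y : X) (f : exit_path x y) : continuous f.
Proof. exact: cts_fun. Qed.

Lemma ep0 (x y : X) (f : exit_path x y) : f zero = x.
Proof. exact: path_zero. Qed.

Lemma ep1 (x y : X) (f : exit_path x y) : f one = y.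
Proof. exact: path_one. Qed.

(* The first coordinate is the path parameter, the second one the homotopy
   parameter. *)
Definition exit_homotopy (x y : X) (f g : exit_path x y) (H : I * I -> X) :=
  [/\ continuous H,
      forall t, H (t, zero) = f t,
      forall t, H (t, one) = g t,
      forall s, H (zero, s) = x /\ H (one, s) = y
    & forall s, exiting (fun t => H (t, s))].

Definition exit_homotopic (x y : X) (f g : exit_path x y) : Prop :=
  exists H, exit_homotopy f g H.

(* Two reparametrizations of an exit path are homotopic by the straight-line
   homotopy of the parameters. *)
Lemma reparam_homotopic (x y z w : X) (f : exit_path x y) (phi psi : I -> I)
    (g h : exit_path z w) :
  continuous phi -> continuous psi ->
  {homo phi : s t / ival s <= ival t} ->
  {homo psi : s t / ival s <= ival t} ->
  phi zero = zero -> psi zero = zero -> phi one = one -> psi one = one ->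
  g =1 f \o phi -> h =1 f \o psi -> exit_homotopic g h.
Proof.
move=> cphi cpsi mphi mpsi phi0 psi0 phi1 psi1 gE hE.
pose k (ts : I * I) : R :=
  (1 - ival ts.2) * ival (phi ts.1) + ival ts.2 * ival (psi ts.1).
have zx : z = x by rewrite -(ep0 g) gE /= phi0 ep0.
have wy : w = y by rewrite -(ep1 g) gE /= phi1 ep1.
exists (fun ts => f (proj01 (k ts))); split.
- apply: comp_continuous; last exact: ep_continuous.
  apply: continuous_proj01.
  have c2 : continuous (fun ts : I * I => ival ts.2).
    by apply: (comp_continuous (@snd_continuous I I)); exact: ival_continuous.
  have c1 (q : I -> I) : continuous q ->
      continuous (fun ts : I * I => ival (q ts.1)).
    move=> cq; apply: (@comp_continuous _ _ _ fst (fun t => ival (q t))).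
      exact: fst_continuous.
    by apply: (comp_continuous cq); exact: ival_continuous.
  apply: real_addf_continuous; apply: real_mulf_continuous;
    [|exact: c1|exact: c2|exact: c1].
  by apply: real_subf_continuous; [exact: cstf_continuous|exact: c2].
- move=> t; rewrite gE /k /= ival_zero; congr (f _).
  by rewrite subr0 mul1r mul0r addr0 proj01K.
- move=> t; rewrite hE /k /= ival_one; congr (f _).
  by rewrite subrr mul1r mul0r add0r proj01K.
- move=> s; rewrite /k /= phi0 psi0 phi1 psi1 ival_zero ival_one.
  rewrite proj01_le0 ?proj01_ge1 ?ep0 ?ep1 ?zx ?wy //.
    by rewrite !mulr1 subrK.
  by rewrite !mulr0 addr0.
- move=> s t t' tt'; apply: ep_exiting; apply: clamp_le; rewrite /k /=.
  have := ival_ge0 s; have := ival_le1 s.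
  by move=> s1 s0; apply: lerD; apply: ler_wpM2l; rewrite ?subr_ge0 ?mphi ?mpsi.
Qed.

Lemma eq_exit_homotopic (x y : X) (f g : exit_path x y) :
  f =1 g -> exit_homotopic f g.
Proof.
move=> fg; apply: (@reparam_homotopic x y x y g id id) => //;
  exact: idf_continuous.
Qed.

Lemma exit_homotopic_refl (x y : X) (f : exit_path x y) : exit_homotopic f f.
Proof. exact: eq_exit_homotopic. Qed.

Lemma exit_homotopic_sym (x y : X) (f g : exit_path x y) :
  exit_homotopic f g -> exit_homotopic g f.
Proof.
move=> [H [cH H0 H1 Hxy Hex]].
exists (fun ts => H (ts.1, proj01 (1 - ival ts.2))); split.
- apply: (comp_continuous _ cH); apply: pair_continuous.
    exact: fst_continuous.
  apply: continuous_proj01; apply: real_subf_continuous.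
    exact: cstf_continuous.
  by apply: (comp_continuous (@snd_continuous I I)); exact: ival_continuous.
- by move=> t /=; rewrite ival_zero subr0 proj01_ge1.
- by move=> t /=; rewrite ival_one subrr proj01_le0.
- by move=> s /=; exact: Hxy.
- by move=> s /=; exact: Hex.
Qed.

Lemma exit_homotopic_trans (x y : X) (f g h : exit_path x y) :
  exit_homotopic f g -> exit_homotopic g h -> exit_homotopic f h.
Proof.
move=> [H [cH H0 H1 Hxy Hex]] [K [cK K0 K1 Kxy Kex]].
exists (fun ts => glue (fun s => H (ts.1, s)) (fun s => K (ts.1, s)) ts.2).
split.
- apply: (@paste_continuous R _ _ (fun ts : I * I => ival ts.2) 2^-1
    (fun ts => H (ts.1, half1 ts.2)) (fun ts => K (ts.1, half2 ts.2))).
  + by apply: (comp_continuous (@snd_continuous I I)); exact: ival_continuous.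
  + apply: (comp_continuous _ cH); apply: pair_continuous.
      exact: fst_continuous.
    by apply: (comp_continuous (@snd_continuous I I)); exact: half1_continuous.
  + apply: (comp_continuous _ cK); apply: pair_continuous.
      exact: fst_continuous.
    by apply: (comp_continuous (@snd_continuous I I)); exact: half2_continuous.
  + move=> [t s] /= sE; rewrite /half1 /half2 sE divff ?pnatr_eq0// subrr.
    by rewrite proj01_ge1// proj01_le0// H1 K0.
- by move=> t; rewrite glue0.
- by move=> t; rewrite glue1.
- by move=> s; rewrite /glue /=; case: ifP => _; [exact: Hxy|exact: Kxy].
- move=> s t t' tt'; rewrite /glue /=.
  by case: ifP => _; [exact: Hex|exact: Kex].
Qed.

Definition exit_homotopicb (x y : X) : rel (exit_path x y) :=
  fun f g => `[< exit_homotopic f g >].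

Lemma exit_homotopicb_equiv (x y : X) : equiv_class_of (@exit_homotopicb x y).
Proof.
split.
- by move=> f; apply/asboolP; exact: exit_homotopic_refl.
- by move=> f g; apply/asboolP/asboolP; exact: exit_homotopic_sym.
- move=> g f h /asboolP fg /asboolP gh; apply/asboolP.
  exact: exit_homotopic_trans gh.
Qed.

Canonical exit_homotopicb_equiv_rel (x y : X) :=
  EquivRelPack (exit_homotopicb_equiv x y).

Definition exit_hom (x y : X) := {eq_quot (exit_homotopicb_equiv_rel x y)}.

Definition exit_class (x y : X) (f : exit_path x y) : exit_hom x y :=
  \pi_(exit_hom x y) f.

Lemma exit_classP (x y : X) (f g : exit_path x y) :
  exit_class f = exit_class g <-> exit_homotopic f g.
Proof.
split; first by move=> /eqquotP /asboolP.
by move=> fg; apply/eqquotP/asboolP.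
Qed.

Lemma exit_hom_ind (x y : X) (K : exit_hom x y -> Prop) :
  (forall f, K (exit_class f)) -> forall u, K u.
Proof. by move=> h u; rewrite -[u]reprK; exact: h. Qed.

Lemma repr_exit_class (x y : X) (f : exit_path x y) :
  exit_homotopic (repr (exit_class f)) f.
Proof. by apply/exit_classP; rewrite /exit_class reprK. Qed.

Definition const_exit (x : X) : exit_path x x.
Proof.
refine (@mk_exit_path x x (fun=> x) _ erefl erefl _) => //.
exact: cstf_continuous.
Defined.

Lemma glue_continuous (x y z : X) (f : exit_path x y) (g : exit_path y z) :
  continuous (glue f g).
Proof.
apply: (@paste_continuous R _ _ (@ival R) 2^-1 (f \o @half1 R) (g \o @half2 R)).
- exact: ival_continuous.
- by apply: (comp_continuous (@half1_continuous R)); exact: ep_continuous.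
- by apply: (comp_continuous (@half2_continuous R)); exact: ep_continuous.
- move=> t /= tE; rewrite /half1 /half2 tE divff ?pnatr_eq0// subrr.
  by rewrite proj01_ge1// proj01_le0// ep0 ep1.
Qed.

Lemma glue_exiting (f g : I -> X) :
  f one = g zero -> exiting f -> exiting g -> exiting (glue f g).
Proof.
move=> fg ef eg s t st; rewrite /glue.
case: ifP => s2; case: ifP => t2.
- exact/ef/half1_le.
- apply: (@le_trans _ _ (S (f one))).
    by apply: ef; rewrite ival_one; exact: ival_le1.
  by rewrite fg; apply: eg; rewrite ival_zero; exact: ival_ge0.
- by rewrite (le_trans st t2) in s2.
- exact/eg/half2_le.
Qed.

Definition concat_exit (x y z : X) (f : exit_path x y) (g : exit_path y z) :
  exit_path x z.
Proof.
refine (@mk_exit_path x z (glue f g) _ _ _ _).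
- exact: glue_continuous.
- by rewrite glue0 ep0.
- by rewrite glue1 ep1.
- apply: glue_exiting; [by rewrite ep0 ep1|exact: ep_exiting..].
Defined.

Lemma concat_homotopic (x y z : X) (f f' : exit_path x y) (g g' : exit_path y z) :
  exit_homotopic f f' -> exit_homotopic g g' ->
  exit_homotopic (concat_exit f g) (concat_exit f' g').
Proof.
move=> [H [cH H0 H1 Hxy Hex]] [K [cK K0 K1 Kxy Kex]].
exists (fun ts => glue (fun t => H (t, ts.2)) (fun t => K (t, ts.2)) ts.1).
split.
- apply: (@paste_continuous R _ _ (fun ts : I * I => ival ts.1) 2^-1
    (fun ts => H (half1 ts.1, ts.2)) (fun ts => K (half2 ts.1, ts.2))).
  + by apply: (comp_continuous (@fst_continuous I I)); exact: ival_continuous.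
  + apply: (comp_continuous _ cH); apply: pair_continuous.
      by apply: (comp_continuous (@fst_continuous I I)); exact: half1_continuous.
    exact: snd_continuous.
  + apply: (comp_continuous _ cK); apply: pair_continuous.
      by apply: (comp_continuous (@fst_continuous I I)); exact: half2_continuous.
    exact: snd_continuous.
  + move=> [t s] /= sE; rewrite /half1 /half2 sE divff ?pnatr_eq0// subrr.
    by rewrite proj01_ge1// proj01_le0// (Hxy s).2 (Kxy s).1.
- by move=> t; rewrite /= /mk_path /glue /= H0 K0.
- by move=> t; rewrite /= /mk_path /glue /= H1 K1.
- by move=> s; rewrite glue0 glue1 (Hxy s).1 (Kxy s).2.
- move=> s; apply: (@glue_exiting (fun t => H (t, s)) (fun t => K (t, s))).
  + by rewrite (Hxy s).2 (Kxy s).1.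
  + exact: Hex.
  + exact: Kex.
Qed.

Lemma concat_const (x y : X) (f : exit_path x y) :
  exit_homotopic (concat_exit f (const_exit y)) f.
Proof.
apply: (@reparam_homotopic x y x y f (@half1 R) id) => //.
- exact: half1_continuous.
- exact: idf_continuous.
- exact: half1_le.
- by apply: proj01_le0; rewrite ival_zero mulr0.
- by apply: proj01_ge1; rewrite ival_one; lra.
move=> t; rewrite /= /mk_path /glue; case: ifP => // /negbT; rewrite -ltNge => t2.
by rewrite /half1 proj01_ge1 ?ep1//; lra.
Qed.

Lemma const_concat (x y : X) (f : exit_path x y) :
  exit_homotopic (concat_exit (const_exit x) f) f.
Proof.
apply: (@reparam_homotopic x y x y f (@half2 R) id) => //.
- exact: half2_continuous.
- exact: idf_continuous.
- exact: half2_le.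
- by apply: proj01_le0; rewrite ival_zero; lra.
- by apply: proj01_ge1; rewrite ival_one; lra.
move=> t; rewrite /= /mk_path /glue; case: ifP => // t2.
by rewrite /half2 proj01_le0 ?ep0//; lra.
Qed.

Lemma concatA (x y z w : X) (f : exit_path x y) (g : exit_path y z)
    (h : exit_path z w) :
  exit_homotopic (concat_exit f (concat_exit g h))
                 (concat_exit (concat_exit f g) h).
Proof.
pose p (r : R) : R := Num.max (r / 2) (Num.max (r - 4^-1) (2 * r - 1)).
have p1 (r : R) : r <= 2^-1 -> p r = r / 2.
  by move=> r2; rewrite /p max_l// ge_max; apply/andP; split; lra.
have p2 (r : R) : 2^-1 <= r <= 3 / 4 -> p r = r - 4^-1.
  move=> /andP[r2 r3]; rewrite /p max_r; first by rewrite max_l//; lra.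
  by rewrite le_max; apply/orP; left; lra.
have p3 (r : R) : 3 / 4 <= r -> p r = 2 * r - 1.
  move=> r3; rewrite /p max_r; first by rewrite max_r//; lra.
  by rewrite le_max; apply/orP; right; lra.
apply: (@reparam_homotopic x w x w (concat_exit (concat_exit f g) h)
  (fun t => proj01 (p (ival t))) id) => //.
- apply: continuous_proj01.
  apply: (comp_continuous (@ival_continuous R)).
  apply: real_maxf_continuous.
    by apply: real_mulf_continuous; [exact: idf_continuous|exact: cstf_continuous].
  apply: real_maxf_continuous.
    by apply: real_subf_continuous; [exact: idf_continuous|exact: cstf_continuous].
  apply: real_subf_continuous; last exact: cstf_continuous.
  by apply: real_mulf_continuous; [exact: cstf_continuous|exact: idf_continuous].
- exact: idf_continuous.
- by move=> s t st; apply: clamp_le; rewrite /p; do !apply: le_max2; lra.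
- by apply: proj01_le0; rewrite ival_zero p1; lra.
- by apply: proj01_ge1; rewrite ival_one p3; lra.
move=> t; rewrite /= /mk_path -[t]proj01K.
have := ival_ge0 t; have := ival_le1 t; move: (ival t) => r r1 r0.
rewrite ival_proj01K ?r0//.
have [r2|r2] := leP r 2^-1.
  rewrite p1// glueE1 ?r0// glueE1; last by apply/andP; split; lra.
  rewrite glueE1; last by apply/andP; split; lra.
  by congr (f (proj01 _)); lra.
rewrite glueE2 ?r2//.
have [r3|r3] := leP r (3 / 4).
  rewrite p2 ?r3 ?andbT ?ltW//.
  rewrite glueE1; last by apply/andP; split; lra.
  rewrite glueE1; last by apply/andP; split; lra.
  rewrite glueE2; last by apply/andP; split; lra.
  by congr (g (proj01 _)); lra.
rewrite p3 ?ltW// glueE2; last by apply/andP; split; lra.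
rewrite glueE2; last by apply/andP; split; lra.
by congr (h (proj01 _)); lra.
Qed.

Definition exit_category : category.
Proof.
refine (@Category X exit_hom (fun x => exit_class (const_exit x))
  (fun x y z g f => exit_class (concat_exit (repr f) (repr g))) _ _ _).
- move=> x y; elim/exit_hom_ind => f; apply/exit_classP.
  apply: exit_homotopic_trans (concat_const f).
  by apply: concat_homotopic; exact: repr_exit_class.
- move=> x y; elim/exit_hom_ind => f; apply/exit_classP.
  apply: exit_homotopic_trans (const_concat f).
  by apply: concat_homotopic; exact: repr_exit_class.
- move=> x y z w h g f; apply/exit_classP.
  apply: (@exit_homotopic_trans _ _ _
    (concat_exit (concat_exit (repr f) (repr g)) (repr h))).
    apply: concat_homotopic; last exact: exit_homotopic_refl.
    exact: repr_exit_class.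
  apply: exit_homotopic_trans (exit_homotopic_sym (concatA _ _ _)) _.
  apply: concat_homotopic; first exact: exit_homotopic_refl.
  exact/exit_homotopic_sym/repr_exit_class.
Defined.

End exit_paths.

Definition enter_category (R : realType) d (P : porderType d)
    (X : topologicalType) (S : stratification P X) : category :=
  op_category (exit_category R S).

Section exit_functor.
Variables (R : realType) (d : Order.disp_t) (P : porderType d).
Variables (X Y : topologicalType).
Variables (S : stratification P X) (T : stratification P Y) (p : X -> Y).
Hypothesis p_continuous : continuous p.
Hypothesis p_stratum : forall x, T (p x) = S x.

Definition map_exit (x y : X) (f : exit_path R S x y) :
  exit_path R T (p x) (p y).
Proof.
refine (@mk_exit_path _ _ _ _ T (p x) (p y) (fun t => p (f t)) _ _ _ _).
- by apply: (comp_continuous _ p_continuous); exact: ep_continuous.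
- by rewrite ep0.
- by rewrite ep1.
- by move=> s t st; rewrite !p_stratum; exact: ep_exiting.
Defined.

Lemma map_exit_homotopic (x y : X) (f g : exit_path R S x y) :
  exit_homotopic f g -> exit_homotopic (map_exit f) (map_exit g).
Proof.
move=> [H [cH H0 H1 Hxy Hex]]; exists (fun ts => p (H ts)); split.
- exact: (comp_continuous cH).
- by move=> t; rewrite H0.
- by move=> t; rewrite H1.
- by move=> s; rewrite (Hxy s).1 (Hxy s).2.
- by move=> s t t' tt'; rewrite !p_stratum; exact: Hex.
Qed.

Definition exit_functor : functor (exit_category R S) (exit_category R T).
Proof.
refine (@Functor (exit_category R S) (exit_category R T) p
  (fun x y f => exit_class (map_exit (repr f))) _ _).
- move=> x; apply/exit_classP.
  apply: (@exit_homotopic_trans _ _ _ _ _ _ _ _ (map_exit (const_exit R S x))).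
    by apply: map_exit_homotopic; exact: repr_exit_class.
  exact: eq_exit_homotopic.
- move=> x y z g f; apply/exit_classP.
  apply: (@exit_homotopic_trans _ _ _ _ _ _ _ _
    (map_exit (concat_exit (repr f) (repr g)))).
    by apply: map_exit_homotopic; exact: repr_exit_class.
  apply: (@exit_homotopic_trans _ _ _ _ _ _ _ _
    (concat_exit (map_exit (repr f)) (map_exit (repr g)))).
    apply: eq_exit_homotopic => t.
    by rewrite /= /mk_path /glue /=; case: ifP.
  by apply: concat_homotopic; apply: exit_homotopic_sym; exact: repr_exit_class.
Defined.

Lemma exit_functorE (x y : X) (f : exit_path R S x y) :
  fmap exit_functor (exit_class f) = exit_class (map_exit f).
Proof. by apply/exit_classP/map_exit_homotopic/repr_exit_class. Qed.

End exit_functor.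

Section conjugacy_poset.
Variable gT : finGroupType.

Definition conjugate_group : rel {group gT} :=
  fun H K => [exists g : gT, (H :^ g)%g == K :> {set gT}].

Lemma conjugate_group_equiv : equiv_class_of conjugate_group.
Proof.
split.
- by move=> H; apply/existsP; exists 1%g; rewrite conjsg1.
- move=> H K; apply/existsP/existsP => -[g /eqP <-]; exists (g^-1)%g;
    by rewrite conjsgK.
- move=> K H L /existsP[g /eqP HK] /existsP[h /eqP KL].
  by apply/existsP; exists (g * h)%g; rewrite conjsgM HK KL.
Qed.

Canonical conjugate_group_equiv_rel := EquivRelPack conjugate_group_equiv.

Definition conj_class : Type := {eq_quot conjugate_group_equiv_rel}.

HB.instance Definition _ := Choice.copy conj_class
  {eq_quot conjugate_group_equiv_rel}.

Definition conj_class_of (H : {group gT}) : conj_class :=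
  \pi_({eq_quot conjugate_group_equiv_rel}) H.

Definition subconj (H K : {group gT}) : bool :=
  [exists g : gT, (H :^ g)%g \subset K].

Definition conj_class_le : rel conj_class :=
  fun C D => subconj (repr C) (repr D).

Lemma conj_class_of_eqP (H K : {group gT}) :
  reflect (exists g, (H :^ g)%g = K) (conj_class_of H == conj_class_of K).
Proof.
apply: (iffP eqP).
- by move=> /eqquotP /existsP[g /eqP gE]; exists g.
- by move=> [g gE]; apply/eqquotP/existsP; exists g; rewrite gE.
Qed.

Lemma repr_conj_class_of (H : {group gT}) :
  exists g, (H :^ g)%g = repr (conj_class_of H).
Proof. by apply/conj_class_of_eqP; rewrite /conj_class_of reprK. Qed.

Lemma conj_class_leE (H K : {group gT}) :
  conj_class_le (conj_class_of H) (conj_class_of K) = subconj H K.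
Proof.
have [g gE] := repr_conj_class_of H; have [h hE] := repr_conj_class_of K.
rewrite /conj_class_le /subconj -gE -hE.
apply/existsP/existsP => -[a Ha].
- exists (g * a * h^-1)%g; rewrite !conjsgM.
  by rewrite -(conjsgK h K) conjSg.
- by exists (g^-1 * a * h)%g; rewrite !conjsgM conjsgK conjSg.
Qed.

Lemma subconj_trans : transitive subconj.
Proof.
move=> K H L /existsP[g HK] /existsP[h KL]; apply/existsP.
exists (g * h)%g; rewrite conjsgM; apply: (fintype.subset_trans _ KL).
by rewrite conjSg.
Qed.

Lemma conj_class_le_refl : reflexive conj_class_le.
Proof. by move=> C; apply/existsP; exists 1%g; rewrite conjsg1. Qed.

Lemma conj_class_le_anti : antisymmetric conj_class_le.
Proof.
move=> C D /andP[/existsP[g CD] /existsP[h DC]].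
rewrite -[C]reprK -[D]reprK; apply/eqquotP/existsP; exists g.
rewrite eqEcard CD cardJg.
by have := subset_leq_card DC; rewrite cardJg.
Qed.

Lemma conj_class_le_trans : transitive conj_class_le.
Proof. by move=> C D E; exact: subconj_trans. Qed.

HB.instance Definition _ := Order.Le_isPOrder.Build (Order.Disp tt tt) conj_class
  conj_class_le_refl conj_class_le_anti conj_class_le_trans.

End conjugacy_poset.

Section orbit_space.
Variables (gT : finGroupType) (X : topologicalType) (rho : {action gT &-> X}).

Definition same_orbit : rel X := fun x y => `[< exists g : gT, rho x g = y >].

Lemma same_orbit_equiv : equiv_class_of same_orbit.
Proof.
split.
- by move=> x; apply/asboolP; exists 1%g; rewrite total_act1.
- move=> x y; apply/asboolP/asboolP => -[g <-]; exists (g^-1)%g;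
    by rewrite total_actK.
- move=> y x z /asboolP[g <-] /asboolP[h <-]; apply/asboolP.
  by exists (g * h)%g; rewrite total_actM.
Qed.

Canonical same_orbit_equiv_rel := EquivRelPack same_orbit_equiv.

Definition orbit_space : topologicalType :=
  quotient_topology {eq_quot same_orbit_equiv_rel}.

Definition orbit_proj (x : X) : orbit_space :=
  \pi_(quotient_topology {eq_quot same_orbit_equiv_rel}) x.

Lemma orbit_proj_continuous : continuous orbit_proj.
Proof. exact: pi_continuous. Qed.

Lemma orbit_projP (x y : X) :
  orbit_proj x = orbit_proj y <-> exists g : gT, rho x g = y.
Proof.
split; first by move=> /eqquotP /asboolP.
by move=> xy; apply/eqquotP/asboolP.
Qed.

Definition stabilizer (x : X) : {set gT} :=
  [set g : gT | `[< rho x g = x >]]%SET.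

Lemma stabilizerP (x : X) (g : gT) : reflect (rho x g = x) (g \in stabilizer x).
Proof. by rewrite /stabilizer finset.in_set; exact: asboolP. Qed.

Lemma stabilizer_group_set (x : X) : group_set (stabilizer x).
Proof.
apply/group_setP; split; first by apply/stabilizerP; exact: total_act1.
move=> g h /stabilizerP gx /stabilizerP hx; apply/stabilizerP.
by rewrite total_actM gx.
Qed.

Canonical stabilizer_group (x : X) := Group (stabilizer_group_set x).

(* The target is the opposite poset: along an exit path stabilizers shrink up
   to conjugacy. *)
Definition isotropy_class (x : X) : (conj_class gT)^d :=
  conj_class_of (stabilizer_group x).

Lemma stabilizer_act (x : X) (g : gT) :
  stabilizer (rho x g) = (stabilizer x :^ g)%g.
Proof.
apply/setP => h; rewrite mem_conjg; apply/stabilizerP/stabilizerP => gh.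
- by rewrite conjgE invgK mulgA !total_actM gh total_actK.
- have : rho (rho x (h ^ g^-1)%g) g = rho x g by rewrite gh.
  by rewrite -total_actM conjgE invgK -!mulgA mulVg mulg1 total_actM.
Qed.

Lemma isotropy_class_act (x : X) (g : gT) :
  isotropy_class (rho x g) = isotropy_class x.
Proof.
apply/esym/eqP/conj_class_of_eqP; exists g.
by rewrite /= stabilizer_act.
Qed.

Definition orbit_isotropy_class (q : orbit_space) : (conj_class gT)^d :=
  isotropy_class (repr (q : {eq_quot same_orbit_equiv_rel})).

Lemma orbit_isotropy_classE (x : X) :
  orbit_isotropy_class (orbit_proj x) = isotropy_class x.
Proof.
have /orbit_projP[g gE] : orbit_proj x =
    orbit_proj (repr (orbit_proj x : {eq_quot same_orbit_equiv_rel})).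
  by apply/esym; exact: reprK.
by rewrite /orbit_isotropy_class -gE isotropy_class_act.
Qed.

Hypothesis X_hausdorff : hausdorff_space X.
Hypothesis rho_continuous : forall g, continuous (rho^~ g).

Lemma near_stabilizer (x : X) :
  \forall y \near x, stabilizer y \subset stabilizer x.
Proof.
have near1 (g : gT) : \forall y \near x, rho y g = y -> rho x g = x.
  have [xg|/eqP xg] := pselect (rho x g = x); first exact: nearW.
  move: X_hausdorff; rewrite open_hausdorff => /(_ _ _ xg).
  move=> [[A B] /= [/set_mem Ax /set_mem Bx] [oA oB /eqP AB]].
  near=> y => yg; exfalso.
  suff : (A `&` B) y by rewrite AB.
  split; last by near: y; exact: open_nbhs_nbhs.
  rewrite -yg; near: y; apply: rho_continuous.
  exact: open_nbhs_nbhs.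
have : \forall y \near x, forall g : gT, rho y g = y -> rho x g = x.
  exact: filter_forall.
apply: filterS => y hy; apply/fintype.subsetP => g /stabilizerP yg.
exact/stabilizerP/hy.
Unshelve. all: by end_near.
Qed.

Lemma isotropy_class_continuous :
  continuous (isotropy_class : X -> alexandrov (conj_class gT)^d).
Proof.
apply/continuousP => U; rewrite alexandrov_openE => upU.
rewrite openE => x Ux; rewrite /interior.
apply: filterS (near_stabilizer x) => y yx.
apply: upU Ux; rewrite leEdual.
rewrite [X in is_true X]conj_class_leE.
by apply/existsP; exists 1%g; rewrite conjsg1.
Qed.

Definition isotropy_stratification : stratification (conj_class gT)^d X :=
  Stratification isotropy_class_continuous.

Lemma orbit_isotropy_class_continuous :
  continuous (orbit_isotropy_class :
                orbit_space -> alexandrov (conj_class gT)^d).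
Proof.
apply/quotient_continuous.
rewrite (_ : _ \o _ = isotropy_class); first exact: isotropy_class_continuous.
by apply/funext => x; exact: orbit_isotropy_classE.
Qed.

Definition orbit_stratification :
  stratification (conj_class gT)^d orbit_space :=
  Stratification orbit_isotropy_class_continuous.

Definition exit_orbit_proj (R : realType) :
  functor (exit_category R isotropy_stratification)
          (exit_category R orbit_stratification) :=
  @exit_functor R _ _ X orbit_space isotropy_stratification
    orbit_stratification orbit_proj orbit_proj_continuous orbit_isotropy_classE.

End orbit_space.

Section smooth_on.
Variables (R : realType) (n m : nat).

Fixpoint Ck_on (k : nat) (U : set 'rV[R]_n) (f : 'rV[R]_n -> 'rV[R]_m) : Prop :=
  {in U, continuous f} /\
  if k is k'.+1 then
    forall i : 'I_n,
      (forall x, U x -> derivable f x (delta_mx 0 i)) /\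
      Ck_on k' U ('D_(delta_mx 0 i) f)
  else True.

Definition smooth_on (U : set 'rV[R]_n) (f : 'rV[R]_n -> 'rV[R]_m) : Prop :=
  forall k, Ck_on k U f.

End smooth_on.

(* [chart_map] and [chart_inv] are total functions; only their values on
   [chart_dom] and on its image are meaningful. *)
Record chart (R : realType) (n : nat) (X : topologicalType) := Chart {
  chart_dom : set X;
  chart_map :> X -> 'rV[R]_n;
  chart_inv : 'rV[R]_n -> X;
  chart_dom_open : open chart_dom;
  chart_cod_open : open (chart_map @` chart_dom);
  chart_mapK : {in chart_dom, cancel chart_map chart_inv};
  chart_map_continuous : {within chart_dom, continuous chart_map};
  chart_inv_continuous : {within chart_map @` chart_dom, continuous chart_inv}
}.

(* The atlas need not be maximal: smoothness of maps only depends on the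
   maximal atlas that it generates. *)
Record manifold (R : realType) (n : nat) := Manifold {
  man_space :> topologicalType;
  man_hausdorff : hausdorff_space man_space;
  man_second_countable : @second_countable man_space;
  man_atlas : set (chart R n man_space);
  man_cover : forall x, exists2 c, man_atlas c & chart_dom c x;
  man_compatible : forall c d, man_atlas c -> man_atlas d ->
    smooth_on (c @` (chart_dom c `&` chart_dom d)) (d \o chart_inv c)
}.

Definition smooth_map (R : realType) (n m : nat) (M : manifold R n)
    (N : manifold R m) (f : M -> N) : Prop :=
  continuous f /\
  forall c d, man_atlas c -> man_atlas d ->
    smooth_on (c @` (chart_dom c `&` f @^-1` chart_dom d))
              (d \o f \o chart_inv c).

Record smooth_action (R : realType) (n : nat) (gT : finGroupType)
    (M : manifold R n) := SmoothAction {
  sact :> {action gT &-> M};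
  sact_smooth : forall g : gT, smooth_map (fun x : M => sact x g)
}.

Section smooth_action.
Variables (R : realType) (n : nat) (gT : finGroupType) (M : manifold R n).
Variable rho : smooth_action gT M.

Lemma sact_continuous (g : gT) : continuous (fun x : M => rho x g).
Proof. exact: (sact_smooth rho g).1. Qed.

Definition enter_space : category :=
  enter_category R (isotropy_stratification (@man_hausdorff _ _ M) sact_continuous).

Definition enter_quotient : category :=
  enter_category R (orbit_stratification (@man_hausdorff _ _ M) sact_continuous).

Definition enter_proj : functor enter_space enter_quotient :=
  op_functor (exit_orbit_proj (@man_hausdorff _ _ M) sact_continuous R).

End smooth_action.

(* Main.v *)
Require Import Defs.
From mathcomp Require Import all_boot all_order all_algebra all_fingroup.
From mathcomp Require Import all_classical all_reals all_analysis.
From mathcomp Require Import homotopy lra.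
Import Defs.
Set Implicit Arguments.
Unset Strict Implicit.
Unset Printing Implicit Defensive.

Import Order.TTheory GRing.Theory Num.Theory.
Import numFieldNormedType.Exports.
Import generic_quotient.

Local Open Scope classical_set_scope.
Local Open Scope ring_scope.
Local Open Scope quotient_scope.

(** The forgetful functor from pointed orbits to orbits is a discrete
    opfibration, and so are its pullbacks.  The theorem therefore says that
    Enter(M) -> Enter(M/G) is the category of elements of a functor
    Enter(M/G) -> Set whose values are transitive G-sets.  That functor sends
    a point of M/G to its fiber, which is an orbit, and the class of an exit
    path f from p to q to the G-map from the fiber of q to the fiber of p that
    takes y to the starting point of the lift of f ending at y.

    Everything rests on one fact: an exit path of M/G, or an exit path
    homotopy, lifts uniquely to M once the END of the lift is prescribed
    ([lift_unique], [lift_exists], [lift_homotopy]).  The end matters: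
    stabilizers shrink along an exit path, so a path leaving a deep stratum
    may have several lifts with the same start, but read backwards it never
    branches.

    The local picture is that of slices.  Every z has arbitrarily small open
    neighborhoods U that are stable under the stabilizer of z and disjoint
    from their other translates ([slice_basis]).  Over the open image of U, a
    connected set of points of M is either inside U or outside of it
    ([slice_connected]); and the points of U whose stratum is at least as deep
    as that of z have the same stabilizer as z ([slice_fixed]), so on them the
    projection is injective ([slice_proj_inj]).  Moving down along an exit path
    from a time t, only such points occur near the point reached at t, which
    makes lifts exist and agree just before t.  The passage from local to
    global is a backward induction on the real line
    ([real_induction_down]), used for uniqueness, for existence and for the
    continuity of the lift of a homotopy.  For existence, the limit step holds
    because a lift over (t, b] is trapped near t in a single translate of a
    slice, and this for arbitrarily small slices, so that it converges.

    Given unique lifting, path lifting passes to homotopy classes and is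
    compatible with concatenation and with the action, which gives
    [fiber_functor]; the projection is faithful on exit path classes, and a
    class f of M/G is the image of a class from x to y exactly when transport
    along f takes y to x.  These are the conditions of
    [is_pullback_criterion]. *)

(** * Arrows and strict pullbacks of categories *)

Lemma existT_inj (T : Type) (P : T -> Type) (t : T) (x y : P t) :
  existT P t x = existT P t y -> x = y.
Proof.
move=> xy; have := projT2_eq xy.
by rewrite (Prop_irrelevance (projT1_eq xy) erefl).
Qed.

(** Arrows bundled with their endpoints: equality of functors makes endpoints
    equal only propositionally, and the arrows over them can then be compared
    without transporting along these equalities. *)
Definition arrow (C : category) (a b : C) (f : hom a b) :
  {a : C & {b : C & hom a b}} := existT _ a (existT _ b f).

Section arrow.
Variable C : category.
Implicit Types a b c : C.

Lemma arrow_inj a b : injective (@arrow C a b).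
Proof. by move=> f g fg; exact: existT_inj (existT_inj fg). Qed.

Lemma arrow_dom a b a' b' (f : hom a b) (f' : hom a' b') :
  arrow f = arrow f' -> a = a'.
Proof. by move=> ff'; exact: (congr1 (@projT1 _ _) ff'). Qed.

Lemma arrow_cod a b a' b' (f : hom a b) (f' : hom a' b') :
  arrow f = arrow f' -> b = b'.
Proof. by move=> ff'; exact: (congr1 (fun x => projT1 (projT2 x)) ff'). Qed.

Lemma arrow_idc a a' : a = a' -> arrow (idc a) = arrow (idc a').
Proof. by move=> ->. Qed.

Lemma arrow_comp a b c a' b' c' (f : hom a b) (g : hom b c)
    (f' : hom a' b') (g' : hom b' c') :
  arrow f = arrow f' -> arrow g = arrow g' ->
  arrow (comp g f) = arrow (comp g' f').
Proof.
move=> ff' gg'; have aa' := arrow_dom ff'; have bb' := arrow_cod ff'.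
have cc' := arrow_cod gg'; subst a' b' c'.
by rewrite (arrow_inj ff') (arrow_inj gg').
Qed.

End arrow.

(** Taken at identities, the hypothesis gives the equality on objects. *)
Lemma functor_ext (C D : category) (F G : functor C D) :
  (forall a b (f : hom a b), arrow (fmap F f) = arrow (fmap G f)) -> F = G.
Proof.
move=> FG; have FGo a : F a = G a by exact: arrow_dom (FG a a (idc a)).
case: F G FG FGo => [Fo Fm F1 FM] [Go Gm G1 GM] /= FG /funext FGo.
subst Go; have FGm : Fm = Gm.
  apply: functional_extensionality_dep => a.
  apply: functional_extensionality_dep => b.
  by apply/funext => f; exact/arrow_inj/FG.
by subst Gm; rewrite (Prop_irrelevance F1 G1) (Prop_irrelevance FM GM).
Qed.

Definition faithful (C D : category) (F : functor C D) : Prop :=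
  forall a b : C, injective (@fmap C D F a b).

(** When both vertical functors are faithful, the functor induced by a
    compatible pair is determined by its values on objects; [hom_exists] says
    that an arrow of C lifts as soon as its image in D comes from an arrow of B
    with the right endpoints, and these lifts are automatically functorial. *)
Section pullback_criterion.
Variables (A B C D : category).
Variables (top : functor A B) (left : functor A C).
Variables (right : functor B D) (bottom : functor C D).
Hypothesis square : comp_functor right top = comp_functor bottom left.
Hypothesis right_faithful : faithful right.
Hypothesis left_faithful : faithful left.
Hypothesis obj_exists : forall b c, right b = bottom c ->
  exists a, top a = b /\ left a = c.
Hypothesis obj_unique : forall a a', top a = top a' -> left a = left a' -> a = a'.
Hypothesis hom_exists : forall a a' (f : hom (top a) (top a'))
  (g : hom (left a) (left a')), arrow (fmap right f) = arrow (fmap bottom g) ->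
  exists h : hom a a', fmap left h = g.

Let square_arrow a a' (h : hom a a') :
  arrow (fmap right (fmap top h)) = arrow (fmap bottom (fmap left h)).
Proof.
by have := congr1 (fun F : functor A D => arrow (fmap F h)) square.
Qed.

Let left_arrow_inj a1 a2 a1' a2' (h : hom a1 a2) (h' : hom a1' a2') :
  a1 = a1' -> a2 = a2' -> arrow (fmap left h) = arrow (fmap left h') ->
  arrow h = arrow h'.
Proof. by move=> ? ?; subst a1' a2' => /arrow_inj /left_faithful ->. Qed.

Let arrow_exists a a' b b' c c' (f : hom b b') (g : hom c c') :
  top a = b -> top a' = b' -> left a = c -> left a' = c' ->
  arrow (fmap right f) = arrow (fmap bottom g) ->
  exists h : hom a a', arrow (fmap top h) = arrow f /\
                       arrow (fmap left h) = arrow g.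
Proof.
move=> ? ? ? ?; subst b b' c c' => fg; have [h hg] := hom_exists fg.
exists h; split; last by rewrite hg.
by congr arrow; apply/right_faithful/arrow_inj; rewrite square_arrow fg hg.
Qed.

Lemma is_pullback_criterion : is_pullback top left right bottom.
Proof.
split=> // E p q pq.
have pqo e : right (p e) = bottom (q e).
  by have := congr1 (fun F : functor E D => F e) pq.
have pqm e e' (m : hom e e') :
    arrow (fmap right (fmap p m)) = arrow (fmap bottom (fmap q m)).
  by have := congr1 (fun F : functor E D => arrow (fmap F m)) pq.
have /choice[uo uoP] e := obj_exists (pqo e).
have lift e e' (m : hom e e') := cid (arrow_exists (uoP e).1 (uoP e').1
  (uoP e).2 (uoP e').2 (pqm e e' m)).
pose um e e' (m : hom e e') := sval (lift e e' m).
have umt e e' (m : hom e e') : arrow (fmap top (um e e' m)) = arrow (fmap p m).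
  exact: (svalP (lift e e' m)).1.
have uml e e' (m : hom e e') : arrow (fmap left (um e e' m)) = arrow (fmap q m).
  exact: (svalP (lift e e' m)).2.
have um1 e : um e e (idc e) = idc (uo e).
  apply/left_faithful/arrow_inj; rewrite uml !fmap1.
  by apply: arrow_idc; case: (uoP e).
have umM e1 e2 e3 (g : hom e2 e3) (f : hom e1 e2) :
    um e1 e3 (comp g f) = comp (um e2 e3 g) (um e1 e2 f).
  apply/left_faithful/arrow_inj; rewrite uml !fmapM.
  by apply: arrow_comp; rewrite uml.
exists (Functor um1 umM); split.
  by split; apply: functor_ext => e e' m /=; [exact: umt|exact: uml].
move=> u' [u't u'l]; apply: functor_ext => e e' m /=.
have u'o e0 : uo e0 = u' e0.
  by apply: obj_unique; rewrite ?(uoP e0).1 ?(uoP e0).2 -?u't -?u'l.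
by apply: left_arrow_inj => //; rewrite uml -u'l.
Qed.

End pullback_criterion.

(** * Backward induction on the real line *)

Lemma near_continuous (T U : topologicalType) (g h : T -> U) (t : T) :
  (\forall s \near t, h s = g s) -> continuous_at t g -> continuous_at t h.
Proof.
move=> hg cg; have ht := nbhs_singleton hg.
move=> N; rewrite ht => /cg; rewrite /nbhs /= => gN.
by apply: filterS2 hg gN => s /= ->.
Qed.

Section real_line.
Variable R : realType.

Lemma clampK (a b t : R) : a <= t <= b -> Num.max a (Num.min t b) = t.
Proof. by move=> /andP[at_ tb]; rewrite min_l// max_r. Qed.

Lemma clamp_itv (a b t : R) : a <= b -> a <= Num.max a (Num.min t b) <= b.
Proof. by move=> ab; rewrite le_max lexx ge_max ab ge_min lexx orbT. Qed.

Lemma clamp_itv_continuous (a b : R) :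
  continuous (fun t : R => Num.max a (Num.min t b)).
Proof.
apply: real_maxf_continuous; first exact: cstf_continuous.
by apply: real_minf_continuous; [exact: idf_continuous|exact: cstf_continuous].
Qed.

Lemma near_at_left (P : R -> Prop) t :
  (\forall s \near t, P s) -> \forall s \near t^'-, P s.
Proof. by apply: (cvg_at_left_filter (cvg_id : id x @[x --> t] --> t)). Qed.

Lemma near_at_right (P : R -> Prop) t :
  (\forall s \near t, P s) -> \forall s \near t^'+, P s.
Proof. by apply: (cvg_at_right_filter (cvg_id : id x @[x --> t] --> t)). Qed.

Lemma near_itv (P : R -> Prop) t : (\forall s \near t, P s) ->
  exists2 e : R, 0 < e & forall s, t - e <= s <= t + e -> P s.
Proof.
move=> [e /= e0 He]; exists (e / 2); first by rewrite divr_gt0.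
move=> s /andP[s1 s2]; apply: He => /=.
by rewrite ltr_norml; apply/andP; split; lra.
Qed.

(** The supremum of the counterexamples below b is approached by
    counterexamples from the left, yet P holds there, by [limit_step], and
    hence just before, by the other step. *)
Lemma real_induction_down (P : R -> Prop) (b : R) :
  P b ->
  (forall t, t <= b -> P t -> \forall s \near t^'-, P s) ->
  (forall t, t < b -> (forall s, t < s <= b -> P s) -> P t) ->
  forall t, t <= b -> P t.
Proof.
move=> Pb left_step limit_step t tb; apply: contrapT => nPt.
pose A := [set s | s <= b /\ ~ P s].
have At : A t by [].
have ubA : ubound A b by move=> s [].
have supA : has_sup A by split; [exists t|exists b].
have cb : sup A <= b by apply: ge_sup => //; exists t.
have above s : sup A < s <= b -> P s.
  move=> /andP[cs sb]; apply: contrapT => nPs.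
  by move: cs; rewrite ltNge (ub_le_sup _ (conj sb nPs))//; exists b.
have Pc : P (sup A).
  by have [->|cltb] := eqVneq (sup A) b; last
    by apply: limit_step => //; rewrite lt_neqAle cltb.
have [e /= e0 He] := left_step _ cb Pc.
have [s [sb nPs] es] := sup_adherent e0 supA.
have sc : s <= sup A by apply: ub_le_sup; [exists b|].
have {}sc : s < sup A.
  by rewrite lt_neqAle sc andbT; apply/eqP => sE; apply: nPs; rewrite sE.
by apply/nPs/He => //=; rewrite ger0_norm ?subr_ge0 1?ltW//; lra.
Qed.

End real_line.

(** * Slices of the action of a finite group *)

Section orbit_lifting.
Variables (gT : finGroupType) (X : topologicalType) (rho : {action gT &-> X}).
Hypothesis X_hausdorff : hausdorff_space X.
Hypothesis rho_continuous : forall g, continuous (rho^~ g).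

Local Notation Q := (orbit_space rho).
Local Notation pr := (@orbit_proj gT X rho).
Local Notation isotropy := (isotropy_class rho).
Local Notation Sx := (isotropy_stratification X_hausdorff rho_continuous).
Local Notation Sq := (orbit_stratification X_hausdorff rho_continuous).

Lemma orbit_proj_act x g : pr (rho x g) = pr x.
Proof. by apply/esym/orbit_projP; exists g. Qed.

Lemma orbit_proj_surj (q : Q) : exists x, pr x = q.
Proof. by exists (repr (q : {eq_quot same_orbit_equiv_rel rho})); exact: reprK. Qed.

Lemma rho_preimage_open g (U : set X) : open U -> open [set x | U (rho x g)].
Proof. by move=> oU; have /continuousP := @rho_continuous g; apply. Qed.

(** The union of the translates of U by the inverses of the elements of K. *)
Definition translates (K : set gT) (U : set X) : set X :=
  [set x | exists2 g, K g & U (rho x g)].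

Lemma translates_open K U : open U -> open (translates K U).
Proof.
move=> oU; rewrite (_ : translates K U = \bigcup_(g in K) [set x | U (rho x g)]).
  by apply: bigcup_open => g _; exact: rho_preimage_open.
by apply/seteqP; split=> x [g Kg Ug]; exists g.
Qed.

Lemma orbit_proj_open (U : set X) : open U -> open (pr @` U).
Proof.
move=> oU; change (open (pr @^-1` (pr @` U))).
rewrite (_ : _ @^-1` _ = translates setT U); first exact: translates_open.
apply/seteqP; split=> x.
  by move=> [u Uu] /esym /orbit_projP[g gE]; exists g; rewrite ?gE.
by move=> [g _ Ug]; exists (rho x g) => //; exact: orbit_proj_act.
Qed.

(** The translates of U by G are then pairwise equal or disjoint, and the
    stabilizer of every point of U is contained in that of z. *)
Record slice (z : X) (U : set X) : Prop := Slice {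
  slice_open : open U;
  slice_center : U z;
  slice_act : forall g u, rho z g = z -> U u -> U (rho u g);
  slice_stab : forall g u, U u -> U (rho u g) -> rho z g = z }.

Lemma slice_nbhs z U : slice z U -> nbhs z U.
Proof. by move=> [oU Uz _ _]; exact: open_nbhs_nbhs. Qed.

Lemma slice_translate z U k : slice z U ->
  slice (rho z k) [set v | U (rho v k^-1%g)].
Proof.
move=> Us; split=> /=.
- exact: rho_preimage_open (slice_open Us).
- by rewrite total_actK; exact: slice_center Us.
- move=> g u zg Uu.
  have -> : rho (rho u g) k^-1%g = rho (rho u k^-1%g) (k * g * k^-1)%g.
    by rewrite -!total_actM !mulgA mulVg mul1g.
  by apply: (slice_act Us) => //; rewrite !total_actM zg total_actK.
- move=> g u Uu Uug.
  suff zg : rho z (k * g * k^-1)%g = z.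
    by rewrite -[in RHS]zg -!total_actM mulgKV.
  by apply: (slice_stab Us Uu); rewrite -total_actM !mulgA mulVg mul1g total_actM.
Qed.

(** Each g that moves z is excluded by separating z from its image; finitely
    many g leave a neighborhood, from which the points that stay in it under
    the whole stabilizer of z are kept. *)
Lemma slice_basis z (N : set X) : nbhs z N -> exists2 U, slice z U & U `<=` N.
Proof.
move=> Nz.
have separating g : exists W, nbhs z W /\
    forall u, W u -> W (rho u g) -> rho z g = z.
  have [zg|/eqP zg] := pselect (rho z g = z); first by
    exists setT; split=> //; exact: filterT.
  move: X_hausdorff; rewrite open_hausdorff => /(_ _ _ zg).
  move=> [[A B] /= [/set_mem Ag /set_mem Bz] [oA oB /eqP AB]].
  exists (B `&` [set u | A (rho u g)]); split.
    apply: filterI; first exact: open_nbhs_nbhs.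
    by apply: open_nbhs_nbhs; split=> //; exact: rho_preimage_open.
  move=> u [_ Au] [Bu _]; exfalso.
  by suff : (A `&` B) (rho u g) by rewrite AB.
have [W WP] := choice separating.
pose V := (N `&` [set u | forall g, W g u])^°.
have nV : V z by apply: filterI => //; by apply: filter_forall => g; exact: (WP g).1.
have VE u : V u -> N u /\ forall g, W g u by move=> /interior_subset.
pose U := [set u | forall g, rho z g = z -> V (rho u g)].
have UV u : U u -> V u by move=> /(_ 1%g); rewrite !total_act1; exact.
exists U; last by move=> u /UV /VE[].
split.
- rewrite openE => u Uu; rewrite /interior /U /=.
  apply: filter_forall => g.
  have [zg|zg] := pselect (rho z g = z); last exact: nearW.
  apply: filterS (_ : nbhs u [set v | V (rho v g)]) => //.
  apply: open_nbhs_nbhs; split; last exact: Uu.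
  by apply: rho_preimage_open; exact: open_interior.
- by move=> g zg; rewrite zg.
- by move=> g u zg Uu h zh; rewrite -total_actM; apply: Uu; rewrite total_actM zg.
- by move=> g u /UV /VE[_ Wu] /UV /VE[_ Wug]; exact: ((WP g).2 u).
Qed.

(** The stabilizer of u is contained in that of z, and the hypothesis on the
    strata gives it at least as many elements: they coincide. *)
Lemma slice_fixed z U u g : slice z U -> U u ->
  (isotropy u <= isotropy z)%O -> rho z g = z -> rho u g = u.
Proof.
move=> Us Uu uz zg.
have subz : stabilizer rho u \subset stabilizer rho z.
  apply/fintype.subsetP => h /stabilizerP uh; apply/stabilizerP.
  by apply: (slice_stab Us Uu); rewrite uh.
apply/stabilizerP; suff -> : stabilizer rho u = stabilizer rho z by apply/stabilizerP.
apply/eqP; rewrite eqEcard subz /=.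
move: uz; rewrite leEdual => uz.
have {uz} : subconj (stabilizer_group rho z) (stabilizer_group rho u).
  by rewrite -conj_class_leE.
by move=> /existsP[h /subset_leq_card]; rewrite cardJg.
Qed.

Lemma slice_proj_inj z U u v : slice z U -> U u -> U v ->
  (isotropy u <= isotropy z)%O -> pr u = pr v -> u = v.
Proof.
move=> Us Uu Uv uz /orbit_projP[g gE].
by rewrite -gE (slice_fixed Us)// (slice_stab Us Uu)// gE.
Qed.

(** The preimage of the image of U is the union of U and of its translates
    disjoint from U, so U is relatively clopen in it. *)
Lemma slice_connected (T : topologicalType) (A : set T) (g : T -> X) z U s :
  slice z U -> connected A -> continuous g ->
  (forall t, A t -> (pr @` U) (pr (g t))) -> A s -> U (g s) ->
  forall t, A t -> U (g t).
Proof.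
move=> Us cA cg gU As Ugs t At.
have cgA : connected (g @` A).
  by apply: connected_continuous_connected => //; exact: continuous_subspaceT.
have E : g @` A `&` U = g @` A.
  apply: cgA.
  - by exists (g s); split=> //; exists s.
  - by exists U => //; exact: slice_open Us.
  exists (~` translates [set k | rho z k <> z] U).
    by apply: open_closedC; exact/translates_open/(slice_open Us).
  apply/seteqP; split=> _ [[r Ar <-]] /=.
    move=> Ugr; split; first by exists r.
    by move=> [k zk Uk]; apply: zk; exact: (slice_stab Us Ugr).
  move=> nt; split; first by exists r.
  have [u Uu /esym /orbit_projP[k kE]] := gU _ Ar.
  have [zk|zk] := pselect (rho z k = z); last by
    exfalso; apply: nt; exists k; rewrite ?kE.
  rewrite -(total_actK rho (g r) k) kE; apply: (slice_act Us) => //.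
  by rewrite -[in LHS]zk total_actK.
have : (g @` A `&` U) (g t) by rewrite E; exists t.
by case.
Qed.

Lemma near_slice_proj (T : topologicalType) (f : T -> Q) t z U :
  continuous f -> slice z U -> f t = pr z -> \forall s \near t, (pr @` U) (f s).
Proof.
move=> cf Us ft; apply: (cf t); apply: open_nbhs_nbhs; split.
  exact/orbit_proj_open/(slice_open Us).
by rewrite ft; exists z => //; exact: slice_center Us.
Qed.

(** Continuity of the section comes from smaller slices inside U, over which
    injectivity forces the section to stay. *)
Lemma slice_section (T : topologicalType) (f : T -> Q) z U :
  slice z U -> continuous f -> (forall t, (pr @` U) (f t)) ->
  (forall t, (Sq (f t) <= isotropy z)%O) ->
  exists g : T -> X, [/\ continuous g, forall t, pr (g t) = f t & forall t, U (g t)].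
Proof.
move=> Us cf fU fz.
have [g gP] := choice (fun t => let: ex_intro2 u Uu uE := fU t in
  ex_intro (fun u => U u /\ pr u = f t) u (conj Uu uE)).
exists g; split=> [t N Ngt|t|t]; [|exact: (gP t).2|exact: (gP t).1].
have NU : nbhs (g t) (N `&` U).
  apply: filterI => //; apply: open_nbhs_nbhs; split; first exact: slice_open Us.
  exact: (gP t).1.
have {NU} [V Vs VNU] := slice_basis NU.
have : \forall s \near t, (pr @` V) (f s).
  by apply: near_slice_proj cf Vs _; rewrite (gP t).2.
rewrite /nbhs /=; apply: filterS => s [v /VNU[Nv Uv] vE] /=.
rewrite (_ : g s = v)//; apply: (slice_proj_inj Us) => //.
- exact: (gP s).1.
- by rewrite -orbit_isotropy_classE (gP s).2; exact: fz.
- by rewrite vE (gP s).2.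
Qed.

(** * Lifting exit paths with a prescribed end *)

Section lifts.
Variable R : realType.

(** Two lifts that agree at t agree just before t because they lie in a slice
    at their common value, on which the projection is injective along the
    path; they agree at limits because the space is Hausdorff. *)
Lemma lift_unique (a b : R) (g1 g2 : R -> X) :
  continuous g1 -> continuous g2 ->
  (forall t, a <= t <= b -> pr (g1 t) = pr (g2 t)) ->
  (forall s t, a <= s -> s <= t -> t <= b -> (isotropy (g1 s) <= isotropy (g1 t))%O) ->
  g1 b = g2 b -> forall t, a <= t <= b -> g1 t = g2 t.
Proof.
move=> c1 c2 g12 eg1 gb.
suff main t : t <= b -> a <= t -> g1 t = g2 t.
  by move=> t /andP[at_ tb]; exact: main.
move: t; apply: real_induction_down => // t tb.
- have [at_|ta] := ltP a t; last first.
    move=> _; near=> s => as_; exfalso; have : s < t by [].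
    by rewrite ltNge (le_trans ta).
  move=> /(_ (ltW at_)) gt.
  have [U Us _] := slice_basis (filterT : nbhs (g1 t) setT).
  have U1 := c1 t _ (slice_nbhs Us).
  have U2 : \forall s \near t, U (g2 s).
    by apply: (c2 t); rewrite -gt; exact: slice_nbhs Us.
  near=> s => as_.
  have st : s < t by [].
  apply: (slice_proj_inj Us).
  - by near: s; exact: near_at_left U1.
  - by near: s; exact: near_at_left U2.
  - by apply: eg1 => //; exact: ltW.
  - by apply: g12; rewrite as_ (le_trans (ltW st)).
move=> Pt at_; apply: contrapT => /eqP g12t.
move: X_hausdorff; rewrite open_hausdorff => /(_ _ _ g12t).
move=> [[A B] /= [/set_mem A1 /set_mem B2] [oA oB /eqP AB]].
have U1 : \forall s \near t, A (g1 s) by apply: (c1 t); exact: open_nbhs_nbhs.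
have U2 : \forall s \near t, B (g2 s) by apply: (c2 t); exact: open_nbhs_nbhs.
near t^'+ => s.
have ts : t < s by [].
have sb : s <= b by near: s; exact: nbhs_right_le.
suff : (A `&` B) (g1 s) by rewrite AB.
split; first by near: s; exact: near_at_right U1.
rewrite Pt ?ts//; last by rewrite (le_trans at_)// ltW.
by near: s; exact: near_at_right U2.
Unshelve. all: by end_near. Qed.

Section existence.
Variables (f : R -> Q) (b : R) (y : X).
Hypothesis f_continuous : continuous f.
Hypothesis f_exiting : forall s t, s <= t -> (Sq (f s) <= Sq (f t))%O.
Hypothesis f_end : pr y = f b.

Let lift_from (t : R) (g : R -> X) :=
  [/\ continuous g, g b = y & forall s, t <= s <= b -> pr (g s) = f s].

Let lift_from_le s t g : s <= t -> lift_from s g -> lift_from t g.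
Proof.
move=> st [cg gb gf]; split=> // r /andP[tr rb].
by apply: gf; rewrite (le_trans st).
Qed.

Let lift_from_isotropy t g r : lift_from t g -> t <= r <= b ->
  isotropy (g r) = Sq (f r).
Proof. by move=> [_ _ gf] tr; rewrite -gf// [RHS]orbit_isotropy_classE. Qed.

Let lift_from_unique t g g' r : lift_from t g -> lift_from t g' ->
  t <= r <= b -> g r = g' r.
Proof.
move=> gl gl' tr; apply: (@lift_unique t b) tr.
- by case: gl.
- by case: gl'.
- by move=> s ts; have [_ _ ->//] := gl; have [_ _ ->] := gl'.
- move=> s u ts su ub; rewrite !(lift_from_isotropy gl) ?ts ?(le_trans su)//.
  + exact: f_exiting.
  + by rewrite (le_trans ts).
- by case: gl => _ -> _; case: gl' => _ ->.
Qed.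

(** Below t the path stays over a slice U at g t and in strata at least as deep
    as that of g t, so it has a section into U, to be pasted to g. *)
Let lift_extend t : t <= b -> (exists g, lift_from t g) ->
  \forall s \near t^'-, exists g, lift_from s g.
Proof.
move=> tb [g gl].
have tt : t <= t <= b by rewrite lexx.
have gtE : pr (g t) = f t by case: gl => _ _ ->.
have [U Us _] := slice_basis (filterT : nbhs (g t) setT).
have [e e0 eU] := near_itv (near_slice_proj f_continuous Us (esym gtE)).
near=> s.
have st : s < t by [].
have es : t - e < s by near: s; apply: nbhs_left_gt; lra.
(* c retracts the line onto [s, t], so that the path becomes one lying over U
   at all times. *)
pose c r := Num.max s (Num.min r t).
have cst r : s <= c r <= t by apply: clamp_itv; exact: ltW.
have cc : continuous (fun r => f (c r)).
  by apply: comp_continuous f_continuous; exact: clamp_itv_continuous.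
have [|r|h [ch hf hU]] := slice_section Us cc.
- by move=> r; apply: eU; have /andP[? ?] := cst r; apply/andP; split; lra.
- rewrite (lift_from_isotropy gl tt); apply: f_exiting.
  by case/andP: (cst r).
have ht : h t = g t.
  apply: (slice_proj_inj Us) => //.
  - exact: slice_center Us.
  - rewrite -[isotropy (h t)]orbit_isotropy_classE hf (lift_from_isotropy gl tt).
    by apply: f_exiting; case/andP: (cst t).
  - by rewrite hf gtE /c clampK// lexx ltW.
exists (fun r => if r <= t then h r else g r); split.
- apply: (@paste_continuous R R X id t h g) => //.
  + exact: idf_continuous.
  + by case: gl.
  + by move=> r /= ->.
- case: leP => bt; last by case: gl.
  have -> : b = t by apply/eqP; rewrite eq_le bt.
  rewrite ht; have [_ <- _] := gl; congr g; apply/eqP.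
  by rewrite eq_le tb.
- move=> r /andP[sr rb]; case: leP => rt.
    by rewrite hf /c clampK// sr.
  by case: gl => _ _ -> //; rewrite rb ltW.
Unshelve. all: by end_near. Qed.

(** By uniqueness the lifts over the intervals [s, b] glue to one over (t, b],
    whose value at s is g s s.  It remains to see that it converges at t to a
    point z over f t, which is done by choosing among the points of that fiber
    the one in whose slice the glued lift remains. *)
Let lift_limit t : t < b -> (forall s, t < s <= b -> exists g, lift_from s g) ->
  exists g, lift_from t g.
Proof.
move=> tb lifts.
have /choice[g gP] s : exists g, t < s <= b -> lift_from s g.
  have [/lifts[g gl]|ns] := pselect (t < s <= b); first by exists g.
  by exists (fun=> y) => /ns.
have gE r s : t < r -> r <= s -> s <= b -> g s s = g r s.
  move=> tr rs sb; apply: (@lift_from_unique s).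
  - by apply: gP; rewrite (lt_le_trans tr).
  - by apply: (lift_from_le rs); apply: gP; rewrite tr (le_trans rs).
  - by rewrite lexx.
have gf s : t < s <= b -> pr (g s s) = f s.
  by move=> ts; have [_ _ ->//] := gP _ ts; rewrite lexx; case/andP: ts.
have [z0 z0E] := orbit_proj_surj (f t).
have [z [t1 [zE tt1 t1b [U Us gU]]]] : exists z t1,
    [/\ pr z = f t, t < t1, t1 <= b & exists2 U, slice z U &
    forall s, t < s <= t1 -> U (g s s)].
  have [U0 U0s _] := slice_basis (filterT : nbhs z0 setT).
  have [d d0 dU0] := near_itv (near_slice_proj f_continuous U0s (esym z0E)).
  pose t1 := Num.min b (t + d).
  have tt1 : t < t1 by rewrite lt_min tb; lra.
  have t1b : t1 <= b by rewrite ge_min lexx.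
  have t1d : t1 <= t + d by rewrite ge_min lexx orbT.
  have [|u Uu] := dU0 t1; first by apply/andP; split; lra.
  rewrite -gf ?tt1// => /orbit_projP[k kE].
  (* The translate of z0 whose slice contains the glued lift at t1. *)
  exists (rho z0 k), t1; split=> //; first by rewrite orbit_proj_act.
  exists [set v | U0 (rho v k^-1%g)]; first exact: slice_translate.
  move=> s /andP[ts st1] /=.
  have sb := le_trans st1 t1b.
  have [cg _ gf'] : lift_from s (g s) by apply: gP; rewrite ts.
  have conn : connected `[s, t1]%classic by exact: segment_connected.
  have cgk : continuous (fun q => rho (g s q) k^-1%g).
    by apply: comp_continuous (@rho_continuous k^-1%g).
  have gU q : [set` `[s, t1]] q -> (pr @` U0) (pr (rho (g s q) k^-1%g)).
    rewrite /= in_itv /= => /andP[sq qt1].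
    rewrite orbit_proj_act gf' ?sq ?(le_trans qt1)//.
    by apply: dU0; apply/andP; split; lra.
  have Ut1 : U0 (rho (g s t1) k^-1%g) by rewrite -gE// -kE total_actK.
  by apply: (slice_connected U0s conn cgk gU _ Ut1); rewrite /= in_itv /= lexx st1.
have near_z V : nbhs z V ->
    exists2 e, 0 < e & forall s, t < s <= t1 -> s <= t + e -> V (g s s).
  move=> zV.
  have [W Ws WVU] : exists2 W, slice z W & W `<=` V `&` U.
    by apply: slice_basis; apply: filterI => //; exact: slice_nbhs Us.
  have [e e0 eW] := near_itv (near_slice_proj f_continuous Ws (esym zE)).
  exists e => // s /andP[ts st1] se.
  have tsb : t < s <= b by rewrite ts (le_trans st1).
  have [|v Wv] := eW s; first by apply/andP; split; lra.
  rewrite -gf// => /orbit_projP[k kE].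
  have zk : rho z k = z.
    apply: (slice_stab Us (WVU _ Wv).2); rewrite kE; apply: gU.
    by rewrite ts.
  by apply: (WVU (g s s) _).1; rewrite -kE; exact: (slice_act Ws).
(* The glued lift is extended constantly beyond b, through m, and below t. *)
pose m r := Num.min r b.
have cm : continuous m.
  by apply: real_minf_continuous; [exact: idf_continuous|exact: cstf_continuous].
exists (fun r => if m r <= t then z else g (m r) (m r)).
have mb r : r <= b -> m r = r by move=> rb; rewrite /m min_l.
split.
- move=> r; have [rt|tr|rt] := ltgtP (m r) t.
  + apply: (near_continuous (g := fun=> z)); last exact: cvg_cst.
    have : \forall s \near r, m s < t by apply: (cm r [set x | x < t]); exact: lt_nbhsl.
    by apply: filterS => s /ltW ->.
  + pose c := (t + m r) / 2.
    have tc : t < c by rewrite /c; lra.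
    have cr : c < m r by rewrite /c; lra.
    have [cg _ _] : lift_from c (g c).
      by apply: gP; rewrite tc (le_trans (ltW cr))// /m ge_min lexx orbT.
    apply: (near_continuous (g := fun s => g c (m s))).
      have : \forall s \near r, c < m s by apply: (cm r [set x | c < x]); exact: lt_nbhsr.
      apply: filterS => s cs; rewrite leNgt (lt_trans tc cs) /=.
      by apply: gE => //; [exact: ltW|rewrite /m ge_min lexx orbT].
    exact: comp_continuous cm cg r.
  + move=> V; rewrite rt lexx => zV; have [e e0 eV] := near_z _ zV.
    have : \forall s \near r, m s < Num.min t1 (t + e).
      by apply: (cm r [set x | x < Num.min t1 (t + e)]); apply: lt_nbhsl;
        rewrite rt lt_min tt1 /=; lra.
    rewrite /nbhs /=; apply: filterS => s; rewrite lt_min => /andP[/ltW s1 /ltW s2] /=.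
    case: leP => ms; last by apply: eV => //; rewrite ms.
    exact: nbhs_singleton zV.
- rewrite mb// leNgt tb /=.
  by have [|_ -> _] := gP b _; first by rewrite tb /=.
- move=> s /andP[ts sb]; rewrite mb//; case: leP => st.
    by rewrite zE; congr f; apply/eqP; rewrite eq_le ts.
  by apply: gf; rewrite st.
Qed.

(** The two steps above are those of the backward induction from b, where
    the constant function at y is a lift. *)
Lemma lift_exists t : t <= b -> exists g, lift_from t g.
Proof.
move: t; apply: real_induction_down.
- exists (fun=> y); split=> //; first exact: cstf_continuous.
  by move=> s; rewrite -eq_le => /eqP <-.
- exact: lift_extend.
- exact: lift_limit.
Qed.

End existence.

(** * Lifting homotopies *)

(** A family of exit paths is lifted one path at a time, with ends that depend
    continuously on the parameter; the point is that the lifts do too. *)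
Section homotopy.
Variables (S : topologicalType) (H : R -> S -> Q) (L : R -> S -> X) (b : R).
Hypothesis H_continuous : continuous (fun p : R * S => H p.1 p.2).
Hypothesis L_continuous : forall s, continuous (L^~ s).
Hypothesis L_lift : forall t s, pr (L t s) = H t s.
Hypothesis L_exiting : forall s t t', t <= t' ->
  (isotropy (L t s) <= isotropy (L t' s))%O.
Hypothesis L_end : continuous (L b).

(** Around (t, s) the homotopy stays over the slice U; within such a box
    [slide] propagates membership in U from one time to another. *)
Let box t s z U : slice z U -> H t s = pr z -> exists2 e, 0 < e &
  \forall s' \near s, forall t', t - e <= t' <= t + e -> (pr @` U) (H t' s').
Proof.
move=> Us Hz; have := near_slice_proj (t := (t, s)) H_continuous Us Hz.
move=> [[A B] /= [tA sB] AB].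
have [e e0 eA] := near_itv tA; exists e => //.
apply: filterS sB => s' Bs' t' /eA At'.
exact: (AB (t', s')).
Qed.

Let slide t s e U z t1 t2 : slice z U ->
  (forall t', t - e <= t' <= t + e -> (pr @` U) (H t' s)) ->
  t - e <= t1 <= t + e -> t - e <= t2 <= t + e -> U (L t1 s) -> U (L t2 s).
Proof.
move=> Us HU t1e t2e Ut1.
have conn : connected `[t - e, t + e]%classic by exact: segment_connected.
apply: (slice_connected Us conn (@L_continuous s) _ _ Ut1).
- by move=> t' /=; rewrite in_itv /= => te; rewrite L_lift; exact: HU.
- by rewrite /= in_itv.
- by rewrite /= in_itv.
Qed.

(** The backward induction concerns continuity in the parameter alone. Below t,
    a point of the lift near s lies in U and in a translate of V, both slices;
    the translating element fixes the center of U, hence also that of V, whose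
    stratum is at least as deep. *)
Lemma lift_continuous_param t : t <= b -> continuous (L t).
Proof.
move=> tb s; move: t tb; apply: real_induction_down.
- exact: L_end.
- move=> t tb cLt.
  have [U Us _] := slice_basis (filterT : nbhs (L t s) setT).
  have [e e0 HU] := box Us (esym (L_lift t s)).
  have Lt : \forall s' \near s, U (L t s') by apply: cLt; exact: slice_nbhs Us.
  near=> t1 => N.
  have t1t : t1 < t by [].
  have t1e : t - e < t1 by near: t1; apply: nbhs_left_gt; lra.
  have {}t1e : t - e <= t1 <= t + e by apply/andP; split; lra.
  have tte : t - e <= t <= t + e by apply/andP; split; lra.
  have LU : \forall s' \near s, U (L t1 s').
    by apply: filterS2 HU Lt => s' HU; exact: (slide Us HU).
  have Ls := nbhs_singleton LU.
  move=> NL; have [V Vs VNU] : exists2 V, slice (L t1 s) V & V `<=` N `&` U.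
    apply: slice_basis; apply: filterI => //.
    by apply: open_nbhs_nbhs; split=> //; exact: slice_open Us.
  have [d d0 HV] := box Vs (esym (L_lift t1 s)).
  rewrite /nbhs /=; apply: filterS2 HV LU => s' HV LU.
  have [|v Vv] := HV t1; first by apply/andP; split; lra.
  rewrite -L_lift => /orbit_projP[k kE].
  apply: (VNU (L t1 s') _).1; rewrite -kE.
  apply: (slice_act Vs) => //; apply: (slice_fixed Us) => //.
    by apply: L_exiting; exact: ltW.
  by apply: (slice_stab Us (VNU _ Vv).2); rewrite kE.
- move=> t tb cL N NL.
  have [U Us UN] := slice_basis NL.
  have [e e0 HU] := box Us (esym (L_lift t s)).
  pose t1 := Num.min b (t + e).
  have tt1 : t < t1 by rewrite lt_min tb; lra.
  have t1b : t1 <= b by rewrite ge_min lexx.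
  have t1e : t - e <= t1 <= t + e.
    by apply/andP; split; [lra|rewrite ge_min lexx orbT].
  have tte : t - e <= t <= t + e by apply/andP; split; lra.
  have Lt1 : U (L t1 s).
    apply: (slide Us (nbhs_singleton HU) tte t1e); exact: slice_center Us.
  have LU : \forall s' \near s, U (L t1 s').
    apply: (cL t1); first by rewrite tt1.
    by apply: open_nbhs_nbhs; split=> //; exact: slice_open Us.
  rewrite /nbhs /=; apply: filterS2 HU LU => s' HU LU.
  by apply: UN; exact: (slide Us HU t1e).
Unshelve. all: by end_near. Qed.

Lemma lift_continuous2 t s : t <= b ->
  {for (t, s), continuous (fun p : R * S => L p.1 p.2)}.
Proof.
move=> tb N /slice_basis[U /= Us UN].
have [e e0 HU] := box Us (esym (L_lift t s)).
have LU : \forall s' \near s, U (L t s').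
  by apply: (lift_continuous_param tb); exact: slice_nbhs Us.
exists ([set t' | t - e < t' < t + e], [set s' | U (L t s') /\
  forall t', t - e <= t' <= t + e -> (pr @` U) (H t' s')]).
  split=> /=; last exact: filterI.
  by near=> t'; apply/andP; split; near: t';
    [apply: lt_nbhsr|apply: lt_nbhsl]; lra.
move=> [t' s'] /= [/andP[t1 t2] [LU' HU']]; apply: UN.
by apply: (slide Us HU' _ _ LU'); apply/andP; split; lra.
Unshelve. all: by end_near. Qed.

End homotopy.

(** * Exit path classes and transport between fibers *)

Local Notation I := (unit_interval R).

Lemma proj01_ival_le (s t : R) : s <= t -> ival (@proj01 R s) <= ival (proj01 t).
Proof. exact: clamp_le. Qed.

Lemma exit_lift_exists (f : I -> Q) (y : X) :
  continuous f -> exiting Sq f -> pr y = f one ->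
  exists g : I -> X, [/\ continuous g, g one = y & forall t, pr (g t) = f t].
Proof.
move=> cf ef yf.
have cF : continuous (fun r : R => f (proj01 r)).
  by apply: (comp_continuous (@proj01_continuous R)).
have [||g [cg g1 gf]] := lift_exists (b := 1) (y := y) cF _ _ (@ler01 R).
- by move=> s t st; apply/ef/proj01_ival_le.
- by rewrite proj01_ge1.
exists (fun t => g (ival t)); split.
- exact: (comp_continuous (@ival_continuous R)).
- by rewrite ival_one.
- by move=> t; rewrite gf ?ival_itv// proj01K.
Qed.

Lemma exit_lift_unique (g1 g2 : I -> X) :
  continuous g1 -> continuous g2 -> (forall t, pr (g1 t) = pr (g2 t)) ->
  exiting Sx g1 -> g1 one = g2 one -> g1 =1 g2.
Proof.
move=> c1 c2 g12 e1 g1E t.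
have h := @lift_unique 0 1 (g1 \o @proj01 R) (g2 \o @proj01 R).
rewrite -(proj01K t); apply: h.
- exact: (comp_continuous (@proj01_continuous R)).
- exact: (comp_continuous (@proj01_continuous R)).
- by move=> s _; exact: g12.
- by move=> r s _ rs _; apply/e1/proj01_ival_le.
- by rewrite /= proj01_ge1.
- exact: ival_itv.
Qed.

Lemma lift_exiting (f : I -> Q) (g : I -> X) :
  (forall t, pr (g t) = f t) -> exiting Sq f -> exiting Sx g.
Proof.
move=> gf ef s t st; have := ef _ _ st.
by rewrite -!gf /= !orbit_isotropy_classE.
Qed.

(** The starting points of the lifted paths form a lift of a constant path,
    hence are constant by uniqueness: the lifted homotopy is again relative to
    its endpoints.  In particular x = x', and when the two are the same term
    the conclusion unfolds to [exit_homotopic g g']. *)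
Lemma lift_homotopy p q (f f' : exit_path R Sq p q) x x' y
    (g : exit_path R Sx x y) (g' : exit_path R Sx x' y) :
  exit_homotopic f f' -> (forall t, pr (g t) = f t) ->
  (forall t, pr (g' t) = f' t) ->
  exists H : I * I -> X, [/\ continuous H, forall t, H (t, zero) = g t,
    forall t, H (t, one) = g' t, forall s, H (zero, s) = x /\ H (one, s) = y
    & forall s, exiting Sx (fun t => H (t, s))].
Proof.
move=> [H [cH H0 H1 Hxy Hex]] gf gf'.
have cHs s : continuous (fun t => H (t, s)).
  apply: (comp_continuous _ cH).
  by apply: pair_continuous; [exact: idf_continuous|exact: cstf_continuous].
have yq s : pr y = H (one, s) by rewrite (Hxy s).2 -(ep1 g) gf ep1.
have /choice[L LP] s : exists l : I -> X,
    [/\ continuous l, l one = y & forall t, pr (l t) = H (t, s)].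
  exact: (exit_lift_exists (cHs s) (Hex s)).
have cL s : continuous (L s) by case: (LP s).
have L1 s : L s one = y by case: (LP s).
have LH s t : pr (L s t) = H (t, s) by case: (LP s).
have eL s : exiting Sx (L s) by exact: lift_exiting (LH s) (Hex s).
have Lg : L zero =1 g.
  apply: exit_lift_unique => //; first exact: ep_continuous.
    by move=> t; rewrite LH gf H0.
  by rewrite L1 ep1.
have cLL : continuous (fun ts : I * I => L ts.2 ts.1).
  move=> [t s].
  have cHR : continuous (fun p : R * I => H (proj01 p.1, p.2)).
    apply: (comp_continuous _ cH); apply: pair_continuous; last exact: snd_continuous.
    by apply: (comp_continuous (@fst_continuous R I)); exact: proj01_continuous.
  have := @lift_continuous2 I (fun r s => H (proj01 r, s))
    (fun r s => L s (proj01 r)) 1 cHR _ _ _ _ (ival t) s (ival_le1 t).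
  have cLR s' : continuous (fun r => L s' (proj01 r)).
    by apply: (comp_continuous (@proj01_continuous R)).
  have LHR r s' : pr (L s' (proj01 r)) = H (proj01 r, s') by [].
  have eLR s' r r' : r <= r' ->
      (isotropy (L s' (proj01 r)) <= isotropy (L s' (proj01 r')))%O.
    by move=> rr; apply/eL/proj01_ival_le.
  have L1R : continuous (fun s' => L s' (proj01 1)).
    under eq_fun do rewrite proj01_ge1// L1.
    exact: cstf_continuous.
  move=> /(_ cLR LHR eLR L1R) cont.
  have -> : (fun ts : I * I => L ts.2 ts.1) =
      (fun p : R * I => L p.2 (proj01 p.1)) \o (fun ts : I * I => (ival ts.1, ts.2)).
    by apply/funext => -[t' s'] /=; rewrite proj01K.
  apply: continuous_comp cont.
  apply: pair_continuous; last exact: snd_continuous.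
  by apply: (comp_continuous (@fst_continuous I I)); exact: ival_continuous.
have cL0 : continuous (fun s => L s zero).
  apply: (@comp_continuous _ _ _ (fun s => (zero, s)) _ _ cLL).
  by apply: pair_continuous; [exact: cstf_continuous|exact: idf_continuous].
have L0 : (fun s => L s zero) =1 (fun=> L one zero).
  apply: exit_lift_unique => // [|s|s t _]; first exact: cstf_continuous.
  - by rewrite !LH !(Hxy _).1.
  - rewrite -[leLHS](orbit_isotropy_classE rho) -[leRHS](orbit_isotropy_classE rho).
    by rewrite !LH !(Hxy _).1.
have Lx s : L s zero = x by rewrite L0 -(L0 zero) Lg ep0.
have Lg' : L one =1 g'.
  apply: exit_lift_unique => //; first exact: ep_continuous.
    by move=> t; rewrite LH gf' H1.
  by rewrite L1 ep1.
by exists (fun ts => L ts.2 ts.1).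
Qed.

(** A relation between points, so as to avoid transporting f along the
    equalities between the projections of x, y and its endpoints p, q. *)
Definition lifts_from (p q : Q) (f : exit_path R Sq p q) (y x : X) : Prop :=
  exists g : exit_path R Sx x y, forall t, pr (g t) = f t.

Lemma lifts_from_exists p q (f : exit_path R Sq p q) y :
  pr y = q -> exists x, lifts_from f y x.
Proof.
move=> yq; have yf : pr y = f one by rewrite ep1.
have [g [cg g1 gf]] := exit_lift_exists (@ep_continuous _ _ _ _ _ _ _ f) (ep_exiting f) yf.
by exists (g zero), (mk_exit_path cg erefl g1 (lift_exiting gf (ep_exiting f))).
Qed.

Lemma lifts_from_homotopic p q (f f' : exit_path R Sq p q) y x x' :
  exit_homotopic f f' -> lifts_from f y x -> lifts_from f' y x' -> x = x'.
Proof.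
move=> ff' [g gf] [g' gf'].
have [H [_ _ H1 Hx _]] := lift_homotopy ff' gf gf'.
by rewrite -(Hx one).1 H1 ep0.
Qed.

Lemma lifts_from_proj p q (f : exit_path R Sq p q) y x :
  lifts_from f y x -> pr x = p.
Proof. by move=> [g gf]; rewrite -(ep0 g) gf ep0. Qed.

Definition hom_lifts (p q : Q) (u : exit_hom R Sq p q) (y x : X) : Prop :=
  lifts_from (repr u) y x.

Lemma hom_lifts_class p q (f : exit_path R Sq p q) y x :
  lifts_from f y x -> hom_lifts (exit_class f) y x.
Proof.
move=> fx; have yq : pr y = q by have [g gf] := fx; rewrite -(ep1 g) gf ep1.
have [x' fx'] := lifts_from_exists (repr (exit_class f)) yq.
by rewrite (lifts_from_homotopic (exit_homotopic_sym (repr_exit_class f)) fx fx').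
Qed.

Lemma hom_lifts_unique p q (u : exit_hom R Sq p q) y x x' :
  hom_lifts u y x -> hom_lifts u y x' -> x = x'.
Proof. exact/lifts_from_homotopic/exit_homotopic_refl. Qed.

Lemma hom_lifts_proj x y (v : exit_hom R Sx x y) :
  hom_lifts (fmap (exit_orbit_proj X_hausdorff rho_continuous R) v) y x.
Proof.
elim/exit_hom_ind: v => g; rewrite exit_functorE; apply: hom_lifts_class.
by exists g.
Qed.

Lemma hom_lifts_id q y : pr y = q ->
  hom_lifts (exit_class (const_exit R Sq q)) y y.
Proof.
by move=> yq; apply: hom_lifts_class; exists (const_exit R Sx y) => t.
Qed.

Lemma hom_lifts_comp p q r (u : exit_hom R Sq p q) (v : exit_hom R Sq q r) x y z :
  hom_lifts v z y -> hom_lifts u y x ->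
  hom_lifts (@comp (exit_category R Sq) p q r v u) z x.
Proof.
move=> [g gv] [f fu]; apply: hom_lifts_class; exists (concat_exit f g) => t.
by rewrite /= /mk_path /glue; case: ifP.
Qed.

Lemma hom_lifts_act p q (u : exit_hom R Sq p q) y x k :
  hom_lifts u y x -> hom_lifts u (rho y k) (rho x k).
Proof.
move=> [g gu].
have cg : continuous (fun t => rho (g t) k).
  by apply: comp_continuous (@rho_continuous k); exact: ep_continuous.
have gu' t : pr (rho (g t) k) = repr u t by rewrite orbit_proj_act.
have g0 : rho (g zero) k = rho x k by rewrite ep0.
have g1 : rho (g one) k = rho y k by rewrite ep1.
by exists (mk_exit_path cg g0 g1 (lift_exiting gu' (ep_exiting _))).
Qed.

Lemma exit_orbit_proj_faithful :
  faithful (exit_orbit_proj X_hausdorff rho_continuous R).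
Proof.
move=> x y; elim/exit_hom_ind => g; elim/exit_hom_ind => g'.
rewrite !exit_functorE => /exit_classP gg'; apply/exit_classP.
exact: (lift_homotopy gg').
Qed.

(** A class of exit paths of the quotient comes from the total space as soon as
    its lift ending at y starts at x: this is the fullness that the projection
    has. *)
Lemma exit_orbit_proj_lift x y (u : exit_hom R Sq (pr x) (pr y)) :
  hom_lifts u y x ->
  exists v : exit_hom R Sx x y,
    fmap (exit_orbit_proj X_hausdorff rho_continuous R) v = u.
Proof.
move=> [g gu]; exists (exit_class g); rewrite exit_functorE -[RHS]reprK.
by apply/exit_classP/eq_exit_homotopic => t; exact: gu.
Qed.

(** * The classifying functors *)

Definition fiber (q : Q) : Type := {x : X | pr x = q}.

Lemma fiber_inj q : injective (@sval X (fun x => pr x = q)).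
Proof. by move=> [x xq] [y yq] /= xy; exact: eq_exist. Qed.

Definition fiber_act q (x : fiber q) (k : gT) : fiber q :=
  exist _ (rho (sval x) k) (etrans (orbit_proj_act (sval x) k) (svalP x)).

Lemma fiber_act1 q (x : fiber q) : fiber_act x 1%g = x.
Proof. by apply: fiber_inj; exact: total_act1. Qed.

Lemma fiber_actM q (x : fiber q) : act_morph (@fiber_act q) x.
Proof. by move=> g h; apply: fiber_inj; exact: total_actM. Qed.

Definition fiber_gset q : gset gT := GSet (TotalAction (@fiber_act1 q) (@fiber_actM q)).

Lemma fiber_transitive q : transitive_gset (fiber_gset q).
Proof.
split; first by have [x xq] := orbit_proj_surj q; exists; exists x.
move=> [x xq] [y yq]; have /orbit_projP[k kE] : pr x = pr y by rewrite xq.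
by exists k; exact: fiber_inj.
Qed.

Definition fiber_orbit q : orbit_category gT := exist _ (fiber_gset q) (fiber_transitive q).

Section transport.
Variables (p q : Q) (u : exit_hom R Sq p q).

Definition transport (y : fiber q) : fiber p :=
  let: exist x xP := cid (lifts_from_exists (repr u) (svalP y)) in
  exist _ x (lifts_from_proj xP).

Lemma transportP y : hom_lifts u (sval y) (sval (transport y)).
Proof. by rewrite /transport; case: cid. Qed.

Lemma transportE y x : hom_lifts u (sval y) (sval x) -> transport y = x.
Proof. by move=> ux; apply/fiber_inj/(hom_lifts_unique (transportP y)). Qed.

Lemma transport_equivariant :
  morph_act (gset_act (fiber_gset q)) (gset_act (fiber_gset p)) transport id.
Proof. by move=> y k /=; apply: transportE; exact/hom_lifts_act/transportP. Qed.

Definition transport_gmap : gmap (fiber_gset q) (fiber_gset p) :=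
  GMap transport_equivariant.

End transport.

(** An arrow of Enter(M/G) from q to p is a class of exit paths from p to q,
    whence the direction of transport. *)
Definition fiber_functor : functor (enter_category R Sq) (orbit_category gT).
Proof.
refine (@Functor (enter_category R Sq) (orbit_category gT) fiber_orbit
  (fun q p u => transport_gmap u) _ _).
- move=> q; apply: gmap_eqP => y; apply: transportE.
  exact: hom_lifts_id (svalP y).
- move=> r q p u v; apply: gmap_eqP => z; apply: transportE.
  exact: hom_lifts_comp (transportP _ _) (transportP _ _).
Defined.

Definition base_point (x : X) : fiber (pr x) := exist _ x erefl.

Lemma transport_base_point x y (v : exit_hom R Sx x y) :
  transport (fmap (exit_orbit_proj X_hausdorff rho_continuous R) v)
    (base_point y) = base_point x.
Proof. by apply: transportE; exact: hom_lifts_proj. Qed.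

Definition pointed_fiber_functor :
  functor (enter_category R Sx) (pointed_orbit_category gT).
Proof.
refine (@Functor (enter_category R Sx) (pointed_orbit_category gT)
  (fun x => @PointedOrbit gT (fiber_orbit (pr x)) (base_point x))
  (fun y x v => exist _ (transport_gmap
     (fmap (exit_orbit_proj X_hausdorff rho_continuous R) v))
     (transport_base_point v)) _ _).
- move=> x; apply: eq_exist; rewrite fmap1.
  exact: (@fmap1 _ _ fiber_functor).
- move=> z y x v w; apply: eq_exist; rewrite fmapM.
  exact: (@fmapM _ _ fiber_functor).
Defined.

Lemma pointed_fiber_inj q q' (y : fiber q) (z : fiber q') : q = q' ->
  @PointedOrbit gT (fiber_orbit q) y = @PointedOrbit gT (fiber_orbit q') z ->
  sval y = sval z.
Proof.
move=> qq'; subst q' => yz.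
(* The record is converted to a sigma type, whose second projection is
   injective over equal first components. *)
pose pack (o : pointed_orbit gT) :=
  existT (fun o' : orbit_category gT => sval o' : Type) (po_orbit o) (po_point o).
by have /= -> := existT_inj (congr1 pack yz).
Qed.

Lemma fiber_pullback : is_pullback pointed_fiber_functor
  (op_functor (exit_orbit_proj X_hausdorff rho_continuous R))
  (forget_point gT) fiber_functor.
Proof.
apply: is_pullback_criterion.
- exact: functor_ext.
- by move=> c c' [f fc] [g gc] /= fg; apply: eq_exist.
- by move=> x y; exact: exit_orbit_proj_faithful.
- move=> [c y] q /= cq; subst c; case: y => x xq; subst q.
  by exists x.
- by move=> x y /= xy pxy; exact: pointed_fiber_inj pxy xy.
- move=> y x [f fy] u fu; apply: exit_orbit_proj_lift.
  have {fu} fE : f = transport_gmap u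
    by apply: (@arrow_inj (orbit_category gT)); exact: fu.
  have tyx : transport u (base_point y) = base_point x by move: fy; rewrite fE.
  by have := transportP u (base_point y); rewrite tyx.
Qed.

End lifts.
End orbit_lifting.

Theorem theorem0p0p2 (R : realType) (gT : finGroupType) (n : nat)
    (M : manifold R n) (rho : smooth_action gT M) :
  exists (Phi : functor (enter_quotient rho) (orbit_category gT))
         (Psi : functor (enter_space rho) (pointed_orbit_category gT)),
    is_pullback Psi (enter_proj rho) (forget_point gT) Phi.
Proof.
exists (fiber_functor (@man_hausdorff _ _ M) (@sact_continuous _ _ _ _ rho) R).
exists (pointed_fiber_functor (@man_hausdorff _ _ M) (@sact_continuous _ _ _ _ rho) R).
exact: fiber_pullback.
Qed.
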